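(* Assume the OMv3 hypothesis. Then any algorithm with polynomial preprocessing time computing incremental {\rm stBP}, and likewise decremental {\rm stBP}, on $n$-node directed graphs requires $n^{\omega+1-o(1)}$ total update time.
   Context: {\rm stBP}: for a directed edge-weighted graph and fixed nodes $s,t$, maintain the maximum over $s$–$t$ paths of the minimum edge weight on the path; incremental means only edge insertions, decremental only edge deletions. $\omega$ is the square matrix multiplication exponent. OMv3 problem: preprocess an $n\times n$ Boolean matrix $A$; then $n$ queries arrive online, each a triple of Boolean vectors $u,v,w\in\{0,1\}^n$, and one must output $\bigvee_{i,j,k}(u_i\wedge v_j\wedge w_k\wedge A_{ij}\wedge A_{jk}\wedge A_{ki})$ before the next query. OMv3 hypothesis: no algorithm with polynomial preprocessing time and total query time $O(n^{\omega+1-\varepsilon})$ solves OMv3, for any $\varepsilon>0$. *)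

(* Defs.v *)
From mathcomp Require Import all_boot all_order all_algebra.
From mathcomp Require Import classical_sets reals exp.

Set Implicit Arguments.
Unset Strict Implicit.
Unset Printing Implicit Defensive.

Import Order.TTheory GRing.Theory Num.Theory.

(* Row-major list of the entries of a matrix. *)
Definition entries (T : Type) (m n : nat) (A : 'M[T]_(m, n)) : seq T :=
  [seq A i j | i <- enum 'I_m, j <- enum 'I_n].

(* Straight-line programs over a ring: each instruction appends one value to
   the list of the values computed so far, which its operands index.  The
   initial list is the list of the inputs. *)
Inductive slp_instr (F : Type) : Type :=
| SlpConst of F
| SlpAdd of nat & nat
| SlpSub of nat & nat
| SlpMul of nat & nat.

Definition slp_value (F : nzRingType) (vs : seq F) (c : slp_instr F) : F :=
  match c with
  | SlpConst a => a
  | SlpAdd i j => (vs`_i + vs`_j)%R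
  | SlpSub i j => (vs`_i - vs`_j)%R
  | SlpMul i j => (vs`_i * vs`_j)%R
  end.

Definition slp_run (F : nzRingType) (p : seq (slp_instr F)) (vs : seq F) :
    seq F :=
  foldl (fun vs c => rcons vs (slp_value vs c)) vs p.

Definition slp_multiplies (F : nzRingType) (n : nat) (p : seq (slp_instr F)) :
    Prop :=
  exists out : 'I_n -> 'I_n -> nat, forall (A B : 'M[F]_n) (i j : 'I_n),
    ((slp_run p (entries A ++ entries B))`_(out i j) = (A *m B) i j)%R.

(* omega is the infimum of the tau such that n x n rational matrices can be
   multiplied with O(n^tau) arithmetic operations. *)
Definition omega (R : realType) : R :=
  inf [set tau : R | exists C : R, forall n : nat, (0 < n)%N ->
    exists p : seq (slp_instr rat),
      slp_multiplies n p /\ ((size p)%:R <= C * n%:R `^ tau)%R]%classic.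

(* Programs act on finitely many named arrays of words (the name and the
   address are both numbers); a scalar variable is an array used only at
   address 0.  Interleaving the arrays in one memory simulates this on a
   single-memory RAM with constant-factor overhead. *)
Inductive binop : Type :=
  OpAdd | OpSub | OpMul | OpDiv | OpMod
| OpAnd | OpOr | OpXor | OpShl | OpShr | OpEq | OpLt.

Definition binop_sem (o : binop) (x y : nat) : nat :=
  match o with
  | OpAdd => x + y
  | OpSub => x - y
  | OpMul => x * y
  | OpDiv => x %/ y
  | OpMod => x %% y
  | OpAnd => Nat.land x y
  | OpOr => Nat.lor x y
  | OpXor => Nat.lxor x y
  | OpShl => x * 2 ^ y
  | OpShr => x %/ 2 ^ y
  | OpEq => x == y
  | OpLt => x < y
  end.

Inductive expr : Type :=
| Const of nat
| Read of nat & expr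
| Bin of binop & expr & expr.

Inductive prog : Type :=
| Skip
| Write of nat & expr & expr
| Seq of prog & prog
| If of expr & prog & prog
| While of expr & prog.

Definition memory := nat -> nat -> nat.

Definition mem_upd (m : memory) (a i x : nat) : memory :=
  fun a' i' => if (a' == a) && (i' == i) then x else m a' i'.

(* Words hold the numbers 0, ..., b.  A computation that produces a larger
   number, even as an intermediate value, is stuck, so words of logarithmic
   length cannot be used to hide longer ones. *)
Definition word (b x : nat) : option nat := if x <= b then Some x else None.

Fixpoint eval (b : nat) (m : memory) (e : expr) : option nat :=
  match e with
  | Const x => word b x
  | Read a e1 => obind (fun i => word b (m a i)) (eval b m e1)
  | Bin o e1 e2 =>
      obind (fun x => obind (fun y => word b (binop_sem o x y)) (eval b m e2))
            (eval b m e1)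
  end.

Fixpoint cost (e : expr) : nat :=
  match e with
  | Const _ => 1
  | Read _ e1 => (cost e1).+1
  | Bin _ e1 e2 => (cost e1 + cost e2).+1
  end.

(* [exec b p m t m'] : from memory m, program p halts in memory m' after t
   elementary steps. *)
Inductive exec (b : nat) : prog -> memory -> nat -> memory -> Prop :=
| ExecSkip m : exec b Skip m 1 m
| ExecWrite a e1 e2 m i x :
    eval b m e1 = Some i -> eval b m e2 = Some x ->
    exec b (Write a e1 e2) m (cost e1 + cost e2).+1 (mem_upd m a i x)
| ExecSeq p1 p2 m1 m2 m3 t1 t2 :
    exec b p1 m1 t1 m2 -> exec b p2 m2 t2 m3 ->
    exec b (Seq p1 p2) m1 (t1 + t2) m3
| ExecIf e p1 p2 m m' x t :
    eval b m e = Some x ->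
    exec b (if x != 0 then p1 else p2) m t m' ->
    exec b (If e p1 p2) m (cost e + t).+1 m'
| ExecWhileEnd e p m :
    eval b m e = Some 0 ->
    exec b (While e p) m (cost e).+1 m
| ExecWhileStep e p m1 m2 m3 x t1 t2 :
    eval b m1 e = Some x -> x != 0 ->
    exec b p m1 t1 m2 -> exec b (While e p) m2 t2 m3 ->
    exec b (While e p) m1 (cost e + t1 + t2).+1 m3.

(* A request consists of the words given to the algorithm and of the set of
   the answers that are correct for it. *)
Definition request := (seq nat * (nat -> Prop))%type.

(* [P n r rs] : for size parameter n, r is an initial request (preprocessing)
   and rs a sequence of later requests that may follow it. *)
Definition online_problem := nat -> request -> seq request -> Prop.

Record algorithm := Algorithm { preprocess : prog; serve : prog }.

(* Inputs are received at the start of array 0 and answers are returned at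
   address 0 of array 1. *)
Definition mem_input (m : memory) (xs : seq nat) : memory :=
  fun a i => if (a == 0) && (i < size xs) then nth 0 xs i else m a i.

Definition answer (m : memory) : nat := m 1 0.

Definition handles (b : nat) (p : prog) (m : memory) (r : request) (t : nat)
    (m' : memory) : Prop :=
  exec b p (mem_input m r.1) t m' /\ r.2 (answer m').

(* The requests are revealed one at a time: a request is loaded only after
   the previous one has been answered. *)
Inductive handles_all (b : nat) (p : prog) :
    memory -> seq request -> nat -> Prop :=
| HandlesNil m : handles_all b p m [::] 0
| HandlesCons m m' r rs t T :
    handles b p m r t m' -> handles_all b p m' rs T ->
    handles_all b p m (r :: rs) (t + T).

(* Words have k * log (n + 2) bits and preprocessing takes at most (n + 2)^k
   steps, where the constant k may depend on the algorithm; f bounds the total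
   time spent on the requests that follow the preprocessing. *)
Definition solves_in (R : realType) (P : online_problem) (alg : algorithm)
    (f : nat -> R) : Prop :=
  exists k : nat, forall (n : nat) (r : request) (rs : seq request),
    (0 < n)%N -> P n r rs ->
    let b := ((n + 2) ^ k)%N in
    exists (t T : nat) (m : memory),
      [/\ handles b (preprocess alg) (fun _ _ => 0) r t m,
          (t <= (n + 2) ^ k)%N,
          handles_all b (serve alg) m rs T
        & (T%:R <= f n)%R].

(* P requires n^(e - o(1)) total time after polynomial preprocessing: no
   algorithm runs in total time O(n^(e - eps)), for any constant eps > 0. *)
Definition requires_total_time (R : realType) (P : online_problem) (e : R) :
    Prop :=
  forall (eps : R) (alg : algorithm), (0 < eps)%R ->
    ~ exists C : R, solves_in P alg (fun n => (C * n%:R `^ (e - eps))%R).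

Definition bits (m n : nat) (A : 'M[bool]_(m, n)) : seq nat :=
  [seq nat_of_bool x | x <- entries A].

Definition OMv3_answer (n : nat) (A : 'M[bool]_n) (u v w : 'rV[bool]_n) :
    bool :=
  [exists i, exists j, exists k,
    [&& u ord0 i, v ord0 j, w ord0 k, A i j, A j k & A k i]].

Definition OMv3_query (n : nat) (A : 'M[bool]_n)
    (q : 'rV[bool]_n * 'rV[bool]_n * 'rV[bool]_n) : request :=
  let: (u, v, w) := q in
  (bits u ++ bits v ++ bits w, fun x => x = OMv3_answer A u v w :> nat).

Definition OMv3 : online_problem := fun n r rs =>
  exists (A : 'M[bool]_n) (qs : seq ('rV[bool]_n * 'rV[bool]_n * 'rV[bool]_n)),
    [/\ size qs = n, r = (n :: bits A, fun _ => True)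
      & rs = [seq OMv3_query A q | q <- qs]].

Definition OMv3_hypothesis (R : realType) : Prop :=
  requires_total_time OMv3 (omega R + 1)%R.

(* A simple directed graph on 'I_n with positive integer edge weights is
   represented by its weight matrix, where 0 stands for a non-edge. *)
Definition edge (n : nat) (G : 'M[nat]_n) : rel 'I_n := fun x y => 0 < G x y.

Definition wdigraph (n W : nat) (G : 'M[nat]_n) : Prop :=
  forall x y, G x x = 0 /\ G x y <= W.

(* p lists the vertices of the path after s. *)
Definition st_path (n : nat) (G : 'M[nat]_n) (s t : 'I_n) (p : seq 'I_n) :
    bool :=
  [&& path (edge G) s p, last s p == t & uniq (s :: p)].

(* The least edge weight on a path with at least one edge. *)
Definition bottleneck (n : nat) (G : 'M[nat]_n) (s : 'I_n) (p : seq 'I_n) :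
    nat :=
  let ws := pairmap (fun x y => G x y) s p in foldr minn (head 0 ws) ws.

(* By convention the value is 0 when there is no path from s to t. *)
Definition stBP_value (n : nat) (G : 'M[nat]_n) (s t : 'I_n) (b : nat) : Prop :=
  (forall p, st_path G s t p -> bottleneck G s p <= b) /\
  ((exists2 p, st_path G s t p & bottleneck G s p = b) \/
   (forall p, ~~ st_path G s t p) /\ b = 0).

(* The update (x, y, w) sets the weight of the edge from x to y to w; it is a
   deletion when w = 0. *)
Definition update (n : nat) := ('I_n * 'I_n * nat)%type.

Definition apply_update (n : nat) (G : 'M[nat]_n) (a : update n) : 'M[nat]_n :=
  let: (x, y, w) := a in
  \matrix_(i, j) if (i == x) && (j == y) then w else G i j.

Definition insertion (n W : nat) (G : 'M[nat]_n) (a : update n) : bool :=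
  let: (x, y, w) := a in [&& x != y, ~~ edge G x y & 0 < w <= W].

Definition deletion (n W : nat) (G : 'M[nat]_n) (a : update n) : bool :=
  let: (x, y, w) := a in edge G x y && (w == 0).

Fixpoint legal (n : nat) (ok : 'M[nat]_n -> update n -> bool) (G : 'M[nat]_n)
    (us : seq (update n)) : bool :=
  if us is a :: us' then ok G a && legal ok (apply_update G a) us' else true.

Fixpoint stBP_updates (n : nat) (s t : 'I_n) (G : 'M[nat]_n)
    (us : seq (update n)) : seq request :=
  if us is a :: us' then
    let G' := apply_update G a in
    ([:: nat_of_ord a.1.1; nat_of_ord a.1.2; a.2], stBP_value G' s t)
      :: stBP_updates s t G' us'
  else [::].

(* Edge weights are integers between 1 and n^c. *)
Definition dynamic_stBP
    (ok : forall n W : nat, 'M[nat]_n -> update n -> bool) (c : nat) :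
    online_problem := fun n r rs =>
  exists (G : 'M[nat]_n) (s t : 'I_n) (us : seq (update n)),
    [/\ wdigraph (n ^ c) G, s != t, legal (ok n (n ^ c)) G us,
        r = ([:: n, nat_of_ord s, nat_of_ord t & entries G], stBP_value G s t)
      & rs = stBP_updates s t G us].

Definition incremental_stBP := dynamic_stBP insertion.
Definition decremental_stBP := dynamic_stBP deletion.

(* Main.v *)
(* Idea.  An OMv3 instance becomes a layered graph on twelve blocks of n nodes,
   whose s-t paths read
     s, P_a, X_i, Y_j, C_b, Y'_j', Z_k, D_d, Z'_k', X'_i', Q_e, t:
   the edges X -> Y, Y' -> Z and Z' -> X' are copies of A, and the remaining
   inner edges are gates.  Since the graph is simple, each index needs its own
   gate for every query; query q uses the edges between index r and shuttle node
   (r + q) mod n, which form a Latin square: each gate edge belongs to one query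
   and the gates of one query are disjoint, so that j = j' and k = k'.
   The gate weights decrease with q and, on the gates of u, with the index.
   Serving query q deletes the gates of its zero bits and then the others,
   starting with those of u.  Just before the gates of i are deleted, a path of
   bottleneck at least their weight has to use query q and i = i', so the answer
   decides whether i is in a triangle.  Run backwards, with the queries in
   reverse order, the same schedule consists of insertions.
   Every query performs 6n updates and O(n) further steps.  Each update takes
   time at least one, so the overhead is within a constant factor of the time
   of the dynamic algorithm; hence no bound on omega is needed. *)
Require Import Defs.
From mathcomp Require Import all_boot all_order all_algebra reals.
From mathcomp Require Import exp zify.

Set Implicit Arguments.
Unset Strict Implicit.
Unset Printing Implicit Defensive.

Import Order.TTheory GRing.Theory Num.Theory.

(** * Machine programs *)

Lemma word_le b x : x <= b -> word b x = Some x.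
Proof. by rewrite /word => ->. Qed.

Lemma word_mono b b' x y : b <= b' -> word b x = Some y -> word b' x = Some y.
Proof. by rewrite /word => lebb'; case: leqP => // lexb <-; rewrite (leq_trans lexb). Qed.

Lemma eval_mono b b' m e x :
  b <= b' -> eval b m e = Some x -> eval b' m e = Some x.
Proof.
move=> lebb'; elim: e x => [c|a e IH|o e1 IH1 e2 IH2] x /=.
- exact: word_mono.
- by case E: (eval b m e) => [i|] //= /(word_mono lebb') W; rewrite (IH _ E).
- case E1: (eval b m e1) => [i|] //=; case E2: (eval b m e2) => [j|] //=.
  by move=> /(word_mono lebb') W; rewrite (IH1 _ E1) (IH2 _ E2).
Qed.

(** The runs of the simulated algorithm are given for its own word bound; this carries them over to
    the larger words of the simulating machine. *)
Lemma exec_mono b b' p m t m' :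
  b <= b' -> exec b p m t m' -> exec b' p m t m'.
Proof.
move=> lebb'; elim=> {p m t m'}.
- exact: ExecSkip.
- by move=> a e1 e2 m i x /(eval_mono lebb') ? /(eval_mono lebb') ?; apply: ExecWrite.
- by move=> *; apply: ExecSeq; eassumption.
- by move=> e p1 p2 m m' x t /(eval_mono lebb') E _ H; apply: (ExecIf E).
- by move=> e p m /(eval_mono lebb') E; apply: ExecWhileEnd.
- move=> e p m1 m2 m3 x t1 t2 /(eval_mono lebb') E nz _ H1 _ H2.
  exact: (ExecWhileStep E nz H1 H2).
Qed.

Lemma exec_gt0 b p m t m' : exec b p m t m' -> 0 < t.
Proof. by elim=> // *; lia. Qed.

(** Moving every array up by two leaves arrays 0 and 1 to the simulating program, for its input and
    registers. The simulated input is then in array 2 and the simulated answer at address 0 of array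
    3. *)
Fixpoint shift_expr (e : expr) : expr :=
  match e with
  | Const x => Const x
  | Read a e1 => Read a.+2 (shift_expr e1)
  | Bin o e1 e2 => Bin o (shift_expr e1) (shift_expr e2)
  end.

Fixpoint shift_prog (p : prog) : prog :=
  match p with
  | Skip => Skip
  | Write a e1 e2 => Write a.+2 (shift_expr e1) (shift_expr e2)
  | Seq p1 p2 => Seq (shift_prog p1) (shift_prog p2)
  | If e p1 p2 => If (shift_expr e) (shift_prog p1) (shift_prog p2)
  | While e p1 => While (shift_expr e) (shift_prog p1)
  end.

Definition simulates (M m : memory) : Prop := forall a i, M a.+2 i = m a i.

Lemma cost_shift e : cost (shift_expr e) = cost e.
Proof. by elim: e => //= [a e ->|o e1 -> e2 ->]. Qed.

Lemma eval_shift b M m e :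
  simulates M m -> eval b M (shift_expr e) = eval b m e.
Proof.
move=> sim; elim: e => //= [a e ->|o e1 -> e2 ->] //.
by case: (eval b m e) => //= i; rewrite sim.
Qed.

(** Costs do not depend on array names, so the time is unchanged. The last two clauses are the frame
    condition: registers and query bits survive a simulated run. *)
Lemma exec_shift b p m t m' M :
  exec b p m t m' -> simulates M m ->
  exists M', [/\ exec b (shift_prog p) M t M', simulates M' m',
                 M' 0 =1 M 0 & M' 1 =1 M 1].
Proof.
move=> ex; elim: ex M => {p m t m'} /=.
- by move=> m M sim; exists M; split=> //; apply: ExecSkip.
- move=> a e1 e2 m i x E1 E2 M sim; exists (mem_upd M a.+2 i x); split=> //.
  + by rewrite -[cost e1]cost_shift -[cost e2]cost_shift;
      apply: ExecWrite; rewrite (eval_shift _ _ sim).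
  + by move=> a' i'; rewrite /mem_upd !eqSS sim.
- move=> p1 p2 m1 m2 m3 t1 t2 _ IH1 _ IH2 M /IH1 [M2 [ex1 /IH2 [M3 [ex2 sim I2 O2]] I1 O1]].
  exists M3; split=> //; first exact: ExecSeq ex1 ex2.
  + by move=> i; rewrite I2.
  + by move=> i; rewrite O2.
- move=> e p1 p2 m m' x t E _ IH M sim; have [M' [ex sim' I O]] := IH _ sim.
  exists M'; split=> //; rewrite -cost_shift; apply: ExecIf.
    by rewrite (eval_shift _ _ sim); exact: E.
  by move: ex; case: ifP.
- move=> e p m E M sim; exists M; split=> //; rewrite -cost_shift.
  by apply: ExecWhileEnd; rewrite (eval_shift _ _ sim).
- move=> e p m1 m2 m3 x t1 t2 E nz _ IH1 _ IH2 M sim.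
  have [M2 [ex1 sim2 I1 O1]] := IH1 _ sim.
  have [M3 [ex2 sim3 I2 O2]] := IH2 _ sim2.
  exists M3; split=> //.
  + rewrite -cost_shift; apply: ExecWhileStep nz ex1 ex2.
    by rewrite (eval_shift _ _ sim).
  + by move=> i; rewrite I2.
  + by move=> i; rewrite O2.
Qed.

(* The value of an expression on a machine with unbounded words. *)
Fixpoint den (m : memory) (e : expr) : nat :=
  match e with
  | Const x => x
  | Read a e1 => m a (den m e1)
  | Bin o e1 e2 => binop_sem o (den m e1) (den m e2)
  end.

(** These operations obey the polynomial bound of [binop_sem_le]; a left shift would be exponential
    in its second operand. *)
Definition tame (o : binop) : bool :=
  match o with
  | OpAdd | OpSub | OpMul | OpDiv | OpMod | OpEq | OpLt => true
  | _ => false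
  end.

Fixpoint safe (B : nat) (m : memory) (e : expr) : Prop :=
  match e with
  | Const x => x <= B
  | Read a e1 => safe B m e1 /\ m a (den m e1) <= B
  | Bin o e1 e2 => [/\ tame o, safe B m e1 & safe B m e2]
  end.

(** An exponent for which [B ^ deg e] bounds all intermediate values of a [safe] expression; for a
    read it must cover the address as well as the word read. *)
Fixpoint deg (e : expr) : nat :=
  match e with
  | Const _ => 1
  | Read _ e1 => (deg e1).+1
  | Bin _ e1 e2 => deg e1 + deg e2
  end.

Lemma deg_gt0 e : 0 < deg e.
Proof. by elim: e => //= o e1 H1 e2 H2; rewrite addn_gt0 H1. Qed.

Lemma binop_sem_le B o x y p q : 1 < B -> 0 < p -> 0 < q -> tame o ->
  x <= B ^ p -> y <= B ^ q -> binop_sem o x y <= B ^ (p + q).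
Proof.
move=> B1 p0 q0 to xp yq.
have Bp : B <= B ^ p by rewrite -{1}(expn1 B) leq_pexp2l // ltnW.
have Bq : B <= B ^ q by rewrite -{1}(expn1 B) leq_pexp2l // ltnW.
have le_x z : z <= x -> z <= B ^ (p + q).
  move=> zx; apply: leq_trans (leq_trans zx xp) _.
  by rewrite leq_pexp2l ?leq_addr // ltnW.
have le_1 (c : bool) : c <= B ^ (p + q).
  by apply: leq_trans (leq_b1 _) _; rewrite expn_gt0 ltnW.
case: o to => //= _.
(* Both bounds are at least 2, so their sum is at most their product. *)
- by rewrite expnD; nia.
- exact/le_x/leq_subr.
- by rewrite expnD leq_mul.
- exact/le_x/leq_div.
- exact/le_x/leq_mod.
Qed.

Lemma den_le B m e : 1 < B -> safe B m e -> den m e <= B ^ deg e.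
Proof.
move=> B1; elim: e => [x|a e IH|o e1 IH1 e2 IH2] /=.
- by rewrite expn1.
- case=> _ /leq_trans-> //.
  by rewrite -{1}(expn1 B) leq_pexp2l // ltnW.
- case=> to /IH1 ? /IH2 ?; exact: binop_sem_le (deg_gt0 _) (deg_gt0 _) _ _ _.
Qed.

Lemma eval_safe B b m e :
  1 < B -> safe B m e -> B ^ deg e <= b -> eval b m e = Some (den m e).
Proof.
move=> B1; have le_expB i j : i <= j -> B ^ i <= B ^ j.
  by move=> ij; rewrite leq_pexp2l // ltnW.
elim: e => [x|a e IH|o e1 IH1 e2 IH2] sf leb.
- by apply: word_le; apply: leq_trans (den_le B1 sf) leb.
- have lev := leq_trans (den_le B1 sf) leb; case: sf => sf _ /=.
  rewrite IH //=; first exact: word_le.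
  by apply: leq_trans leb; apply: le_expB; rewrite /= leqnSn.
- have lev := leq_trans (den_le B1 sf) leb; case: sf => _ sf1 sf2 /=.
  rewrite IH1 //=; last by apply: leq_trans leb; apply: le_expB; rewrite leq_addr.
  rewrite IH2 //=; last by apply: leq_trans leb; apply: le_expB; rewrite leq_addl.
  exact: word_le.
Qed.

(** A rule for counted loops. The invariant also carries the time spent so far, so it can trade that
    time against the time left to the simulated algorithm. The final [(cost e).+1] pays for the
    failing test. *)
Lemma exec_count b e p (I : nat -> nat -> memory -> Prop) K :
  (forall j s m, j < K -> I j s m -> eval b m e = Some 1 /\
     exists t m', exec b p m t m' /\ I j.+1 (s + (cost e + t).+1) m') ->
  (forall s m, I K s m -> eval b m e = Some 0) ->
  forall j s m, j <= K -> I j s m ->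
  exists t s' m', [/\ exec b (While e p) m t m', I K s' m'
                    & s + t = s' + (cost e).+1].
Proof.
move=> step stop j s m leK; have [d dE] : exists d, K = j + d.
  by exists (K - j); rewrite subnKC.
elim: d => [|d IH] in j s m leK dE *.
  move=> Ij; have Kj : K = j by lia.
  exists (cost e).+1, s, m; split; [|by rewrite Kj|by []].
  by apply: ExecWhileEnd; apply: (stop s); rewrite Kj.
move=> Ij; have jK : j < K by lia.
have [ev [t [m' [ex Ij']]]] := step _ _ _ jK Ij.
have dE' : K = j.+1 + d by lia.
have [t' [s' [m'' [ex' IK eqs]]]] := IH _ _ _ jK dE' Ij'.
exists (cost e + t + t').+1, s', m''; split=> //; last by lia.
exact: (ExecWhileStep ev isT ex ex').
Qed.

Lemma nth_flatten_map (T S : Type) (x0 : T) (y0 : S) (f : S -> seq T) k s i j :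
  (forall y, size (f y) = k) -> i < size s -> j < k ->
  nth x0 (flatten [seq f y | y <- s]) (i * k + j) = nth x0 (f (nth y0 s i)) j.
Proof.
move=> szf; elim: s i => //= y s IH [|i] ltis ltjk.
  by rewrite nth_cat szf mul0n add0n ltjk.
rewrite nth_cat szf ltnNge (_ : k <= i.+1 * k + j) ?mulSn -?addnA ?leq_addr //=.
by rewrite addKn IH.
Qed.

Lemma size_entries (T : Type) (m n : nat) (A : 'M[T]_(m, n)) :
  size (entries A) = m * n.
Proof. by rewrite size_allpairs -!cardE !card_ord. Qed.

Lemma nth_entries (T : Type) (m n : nat) (A : 'M[T]_(m, n)) x0 i j :
  nth x0 (entries A) (nat_of_ord i * n + nat_of_ord j) = A i j.
Proof.
rewrite (nth_flatten_map x0 i) ?size_enum_ord //; last first.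
  by move=> y; rewrite size_map size_enum_ord.
by rewrite (nth_map j) ?nth_ord_enum // size_enum_ord.
Qed.

(** * The gadget graph *)

Lemma divMD q d j : j < d -> (q * d + j) %/ d = q.
Proof. by move=> lt; rewrite divnMDl ?divn_small ?addn0 //; apply: leq_ltn_trans lt. Qed.

Lemma modMD q d j : j < d -> (q * d + j) %% d = j.
Proof. by move=> lt; rewrite modnMDl modn_small. Qed.

(** Element [r] and shuttle [s] determine the query [t], and [r] and [t] determine [s]. Hence the
    gate edges of distinct queries are distinct. *)
Lemma latin_square n r t s : r < n -> t < n -> s < n ->
  ((s + n - r) %% n == t) = (s == (r + t) %% n).
Proof.
move=> rn tn sn; have -> : (r + t) %% n = if r + t < n then r + t else r + t - n.
  case: ltnP => h; first by rewrite modn_small.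
  by rewrite -{1}(subnK h) modnDr modn_small //; lia.
have -> : (s + n - r) %% n = if r <= s then s - r else s + n - r.
  case: leqP => h; last by rewrite modn_small //; lia.
  by rewrite -addnBAC // modnDr modn_small //; lia.
by case: (ltnP (r + t) n) => ?; case: (leqP r s) => ?; apply/idP/idP => /eqP ?; apply/eqP; lia.
Qed.

Section Gadget.
Variables (n : nat) (a : rel nat) (bit : nat -> nat -> bool).

(* Node [x] is the element [x %% n] of block [x %/ n], and edges go from a block
   to the next one.  Blocks 0 and 11 contain s and t.  Edges leaving the blocks
   2, 5, 8 copy the matrix; those leaving 3, 6, 9 go from an element to a
   shuttle, and those leaving 1, 4, 7 from a shuttle to an element.  The role
   0, 1, 2 of a gate tells which of the vectors u, v, w controls it. *)
Definition role (l : nat) : nat := (l %/ 3) %% 3.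
Definition elem (l i j : nat) : nat := if l %% 3 == 0 then i else j.
Definition shuttle (l i j : nat) : nat := if l %% 3 == 0 then j else i.
Definition gate_query (l i j : nat) : nat :=
  (shuttle l i j + n - elem l i j) %% n.
Definition gate_bit (l i j : nat) : nat := role l * n + elem l i j.
(* The global number of the slot in which an edge is deleted. *)
Definition expiry (l i j : nat) : nat :=
  let q := gate_query l i j in let g := gate_bit l i j in
  q * (12 * n) + (bit q g * (6 * n) + (g * 2 + (l %% 3 == 0))).
(** For [r < n], the levels of query [q] lie in a window of length [n] that ends at [n * n - q * n].
    The windows of distinct queries are disjoint, so a threshold on the bottleneck excludes all
    later queries. *)
Definition level (q rho r : nat) : nat := n * n - (q * n + (rho == 0) * r).

Definition dynamic (l : nat) : bool := (l %% 3 != 2) && (0 < l < 10).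

(** [T] is the number of slots already processed, so an edge is still present at time [T = expiry].
    Static edges have the maximal weight [n * n] and never constrain the bottleneck. *)
Definition layer_weight (T l i j : nat) : nat :=
  if l %% 3 == 2 then a i j * (n * n)
  else if dynamic l then
    (T <= expiry l i j) * level (gate_query l i j) (role l) (elem l i j)
  else n * n.

Definition weight (T x y : nat) : nat :=
  (y %/ n == (x %/ n).+1) * layer_weight T (x %/ n) (x %% n) (y %% n).

(* Slot [h < 12 * n] of a query handles one gate edge: the edges of zero bits in
   pass 0 and those of one bits in pass 1. *)
Definition slot_pass (h : nat) : nat := h %/ (6 * n).
Definition slot_gate (h : nat) : nat := (h %% (6 * n)) %/ 2.
(** Side 1 is an edge from an element to its shuttle and side 0 an edge from a shuttle to its
    element, as in the last summand of [expiry]. *)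
Definition slot_side (h : nat) : nat := (h %% (6 * n)) %% 2.
Definition slot_role (h : nat) : nat := slot_gate h %/ n.
Definition slot_elem (h : nat) : nat := slot_gate h %% n.
Definition slot_shuttle (q h : nat) : nat := (slot_elem h + q) %% n.
(** Sides 1 and 0 are in the layers [3 * role] and [3 * role + 1], except that side 1 of role 0 is
    in layer 9. Case distinctions are written as arithmetic so that the program expressions evaluate
    to these formulas by computation. *)
Definition slot_layer (h : nat) : nat :=
  3 * slot_role h + ((1 - slot_side h) + 9 * (slot_side h * (slot_role h == 0))).
Definition slot_tail (q h : nat) : nat :=
  slot_side h * slot_elem h + (1 - slot_side h) * slot_shuttle q h.
Definition slot_head (q h : nat) : nat :=
  slot_side h * slot_shuttle q h + (1 - slot_side h) * slot_elem h.
Definition slot_level (q h : nat) : nat := level q (slot_role h) (slot_elem h).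
Definition active (q h : nat) : bool := nat_of_bool (bit q (slot_gate h)) == slot_pass h.

Hypothesis n_gt0 : 0 < n.

(** * Correspondence of active slots and gate edges *)

Lemma slot_bounds h : h < 12 * n ->
  [/\ slot_pass h < 2, slot_gate h < 3 * n, slot_side h < 2, slot_role h < 3
    & slot_elem h < n].
Proof.
move=> hn; have lt6 : h %% (6 * n) < 6 * n by rewrite ltn_mod; lia.
have g3 : slot_gate h < 3 * n by rewrite /slot_gate ltn_divLR //; lia.
split=> //; try by rewrite ?ltn_mod.
- by rewrite /slot_pass ltn_divLR; lia.
- by rewrite /slot_role ltn_divLR.
Qed.

Lemma slotE h :
  h = slot_pass h * (6 * n) + ((slot_role h * n + slot_elem h) * 2 + slot_side h).
Proof. by rewrite /slot_role /slot_elem -!divn_eq. Qed.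

Lemma slot_tail_head_lt q h : h < 12 * n -> slot_tail q h < n /\ slot_head q h < n.
Proof.
move=> /slot_bounds[_ _ + _ en]; have sn : slot_shuttle q h < n by rewrite ltn_mod.
by rewrite /slot_tail /slot_head; case: (slot_side h) => [|[|]] //= _; lia.
Qed.

Lemma slot_gateE h : slot_gate h = slot_role h * n + slot_elem h.
Proof. exact: divn_eq. Qed.

Lemma slot_layerP q h : q < n -> h < 12 * n ->
  let l := slot_layer h in let i := slot_tail q h in let j := slot_head q h in
  [/\ dynamic l, role l = slot_role h, elem l i j = slot_elem h,
      gate_query l i j = q & (l %% 3 == 0) = slot_side h :> nat].
Proof.
move=> qn hn /=; have [_ _ d2 r3 en] := slot_bounds hn.
have sn : slot_shuttle q h < n by rewrite ltn_mod.
have gq : (slot_shuttle q h + n - slot_elem h) %% n = q.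
  by apply/eqP; rewrite latin_square.
rewrite /gate_query /shuttle /elem /slot_layer /slot_tail /slot_head.
case: (slot_side h) (slot_role h) d2 r3 => [|[|]] // [|[|[|]]] //= _ _;
  rewrite !(mul0n, mul1n, add0n, addn0, subnn, subn0) //.
Qed.

Lemma expiry_slot q h : q < n -> h < 12 * n -> active q h ->
  expiry (slot_layer h) (slot_tail q h) (slot_head q h) = q * (12 * n) + h.
Proof.
move=> qn hn act; have [_ rE eE qE dE] := slot_layerP qn hn.
rewrite /expiry /gate_bit rE eE qE dE -slot_gateE (eqP act).
by rewrite slot_gateE -slotE.
Qed.

Lemma elem_shuttle_lt l i j : i < n -> j < n -> elem l i j < n /\ shuttle l i j < n.
Proof. by rewrite /elem /shuttle; case: ifP. Qed.

Lemma gate_bit_lt l i j : i < n -> j < n -> gate_bit l i j < 3 * n.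
Proof.
move=> ilt jlt; have [e _] := elem_shuttle_lt l ilt jlt.
have : role l < 3 by rewrite ltn_mod.
by rewrite /gate_bit; nia.
Qed.

Lemma gate_query_lt l i j : gate_query l i j < n.
Proof. by rewrite ltn_mod. Qed.

Lemma dynamic_layerE l : dynamic l ->
  l = 3 * role l + ((1 - (l %% 3 == 0)) + 9 * ((l %% 3 == 0) * (role l == 0))).
Proof. by rewrite /dynamic /role; do 10 (case: l => [|l] //); case/andP. Qed.

(** Converse of [expiry_slot]: the mixed-radix digits of the expiry are unique, and they encode
    query, pass, gate and side. Thus no two gate edges share a slot. *)
Lemma slot_expiry l i j q h : dynamic l -> i < n -> j < n -> h < 12 * n ->
  expiry l i j = q * (12 * n) + h ->
  [/\ q = gate_query l i j, active q h, l = slot_layer h, i = slot_tail q h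
    & j = slot_head q h].
Proof.
move=> dl ilt jlt hn; have [elt sht] := elem_shuttle_lt l ilt jlt.
have glt := gate_bit_lt l ilt jlt; have qlt := gate_query_lt l i j.
rewrite /expiry; set q' := gate_query l i j in qlt *; set g := gate_bit l i j in glt *.
set d := l %% 3 == 0; set B := bit q' g; set e := g * 2 + d.
have e6 : e < 6 * n by rewrite /e; case: (d); lia.
have eta12 : B * (6 * n) + e < 12 * n by case: (B); lia.
move=> eqT; have qE : q = q' by rewrite -(divMD q hn) -eqT divMD.
have hE : h = B * (6 * n) + e by rewrite -(modMD q hn) -eqT modMD.
have pE : slot_pass h = B by rewrite /slot_pass hE divMD.
have gE : slot_gate h = g.
  by rewrite /slot_gate hE modMD // /e divMD //; case: (d).
have sE : slot_side h = d by rewrite /slot_side hE modMD // /e modMD //; case: (d).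
have rE : slot_role h = role l by rewrite /slot_role gE divMD.
have eE : slot_elem h = elem l i j by rewrite /slot_elem gE modMD.
have shE : slot_shuttle q h = shuttle l i j.
  rewrite /slot_shuttle eE; apply/esym/eqP; rewrite -latin_square //.
    by rewrite qE.
  by rewrite qE.
split=> //.
- by rewrite /active gE pE qE.
- by rewrite /slot_layer sE rE; exact: dynamic_layerE.
- rewrite /slot_tail sE eE shE /elem /shuttle -/d.
  by case: (d); rewrite /= ?mul0n ?mul1n ?addn0 ?add0n.
- rewrite /slot_head sE eE shE /elem /shuttle -/d.
  by case: (d); rewrite /= ?mul0n ?mul1n ?addn0 ?add0n.
Qed.

Definition slot_source (q h : nat) : nat := slot_layer h * n + slot_tail q h.
Definition slot_target (q h : nat) : nat := (slot_layer h).+1 * n + slot_head q h.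

(** * Weights as functions of time *)

Lemma level_gt0 q rho r : q < n -> r < n -> 0 < level q rho r.
Proof. by rewrite /level; case: eqP => _ /= qn rn; nia. Qed.

Lemma level_le q rho r : level q rho r <= n * n.
Proof. exact: leq_subr. Qed.

Lemma layer_weight_le T l i j : layer_weight T l i j <= n * n.
Proof.
rewrite /layer_weight; case: ifP => _; first by case: (a i j); lia.
case: ifP => // _; case: (T <= _); rewrite ?mul0n ?mul1n //; exact: level_le.
Qed.

Lemma weight_le T x y : weight T x y <= n * n.
Proof.
rewrite /weight; case: eqP => _; rewrite ?mul0n ?mul1n //; exact: layer_weight_le.
Qed.

Lemma weight_diag T x : weight T x x = 0.
Proof. by rewrite /weight; case: eqP => //; lia. Qed.

Lemma slot_ends q h : h < 12 * n ->
  [/\ slot_source q h %/ n = slot_layer h, slot_source q h %% n = slot_tail q h,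
      slot_target q h %/ n = (slot_layer h).+1
    & slot_target q h %% n = slot_head q h].
Proof.
by move=> /(slot_tail_head_lt q)[? ?]; rewrite !(divMD, modMD).
Qed.

Lemma slot_source_lt q h : q < n -> h < 12 * n -> slot_source q h < 12 * n.
Proof.
move=> qn hn; have [/andP[_ l10] _ _ _ _] := slot_layerP qn hn.
have [tn _] := slot_tail_head_lt q hn.
by rewrite /slot_source; move: (slot_layer h) l10 tn => l; nia.
Qed.

Lemma slot_target_lt q h : q < n -> h < 12 * n -> slot_target q h < 12 * n.
Proof.
move=> qn hn; have [/andP[_ l10] _ _ _ _] := slot_layerP qn hn.
have [_ tn] := slot_tail_head_lt q hn.
by rewrite /slot_target; move: (slot_layer h) l10 tn => l; nia.
Qed.

Lemma weight_slot T q h : q < n -> h < 12 * n -> active q h ->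
  weight T (slot_source q h) (slot_target q h) =
  (T <= q * (12 * n) + h) * slot_level q h.
Proof.
move=> qn hn act; rewrite /weight; have [-> -> -> ->] := slot_ends q hn.
have [dl rE eE qE dE] := slot_layerP qn hn.
rewrite eqxx mul1n /layer_weight dl (negPf (proj1 (andP dl))).
by rewrite expiry_slot // rE eE qE.
Qed.

(** Only an edge whose expiry is exactly [T] changes, and by [slot_expiry] it can only be the edge
    of the slot. *)
Lemma weight_step q h x y : q < n -> h < 12 * n ->
  let T := q * (12 * n) + h in
  weight T.+1 x y =
  if [&& active q h, x == slot_source q h & y == slot_target q h] then 0
  else weight T x y.
Proof.
move=> qn hn /=; case: ifP => [/and3P[act /eqP-> /eqP->]|neq].
  by rewrite weight_slot // ltnn mul0n.
rewrite /weight; case: eqP => // yx; rewrite !mul1n /layer_weight.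
case: ifP => // _; case: ifP => // dl; congr (_ * _).
rewrite ltn_neqAle; case: eqP => //= eqT; case/negP: neq.
have [||qE act lE iE jE] := slot_expiry dl _ _ hn (esym eqT); rewrite ?ltn_mod //.
rewrite act /slot_source /slot_target -lE -iE -jE -yx -!divn_eq.
by rewrite !eqxx.
Qed.

(** * Heavy paths and triangles *)

Definition triangle (q i j k : nat) : bool :=
  [&& bit q i, bit q (n + j), bit q (2 * n + k), a i j, a j k & a k i].

(** Gates of earlier queries have expired by time [q * (12 * n)], and those of later queries weigh
    at most [n * n - q.+1 * n], which is below [th]. The last clause is [th <= level] freed of
    truncated subtraction. *)
Lemma alive_gate T q l i j th : q < n -> dynamic l -> i < n -> j < n ->
  q * (12 * n) <= T -> n * n < th + (q.+1 * n) -> 0 < th ->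
  th <= layer_weight T l i j ->
  [/\ gate_query l i j = q, T <= expiry l i j
    & (role l == 0) * elem l i j + (q * n + th) <= n * n].
Proof.
move=> qn dl ilt jlt Tge thge th0; have [elt _] := elem_shuttle_lt l ilt jlt.
rewrite /layer_weight dl (negPf (proj1 (andP dl))).
case: (leqP T) => [Tle|_]; last by rewrite mul0n; lia.
rewrite mul1n /level => le_th.
have [lt|gt|eq] := ltngtP (gate_query l i j) q.
- have := gate_bit_lt l ilt jlt; move: Tle; rewrite /expiry.
  set B := bit _ _; set d := l %% 3 == 0; move: (gate_bit _ _ _) => g.
  by move: (gate_query l i j) lt => q'; case: (B); case: (d) => /= *; nia.
- by move: (gate_query l i j) gt le_th => q' gt; nia.
- by split=> //; move: le_th; rewrite eq; move: (_ * elem _ _ _) => z; lia.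
Qed.

Lemma weight_edge T x y th : 0 < th -> th <= weight T x y ->
  y %/ n = (x %/ n).+1 /\ th <= layer_weight T (x %/ n) (x %% n) (y %% n).
Proof.
by rewrite /weight; case: eqP => [->|_]; rewrite ?mul1n ?mul0n //=; lia.
Qed.

(** Every edge of positive weight advances by one block, so a path from block 0 to block 11 has
    exactly 11 edges. *)
Lemma path_block T th x p : 0 < th -> path (fun x y => th <= weight T x y) x p ->
  last x p %/ n = x %/ n + size p.
Proof.
move=> th0; elim: p x => [|y p IH] x /=; first by rewrite addn0.
by case/andP=> /(weight_edge th0)[e _] /IH ->; rewrite e addSnnS.
Qed.

Lemma adjacency_edge T l i j th : 0 < th -> l %% 3 == 2 ->
  th <= layer_weight T l i j -> a i j.
Proof.
by move=> th0 l2; rewrite /layer_weight l2; case: (a i j) => //=; rewrite mul0n; lia.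
Qed.

(* Once the edges of the zero bits of query [q] are gone, a path of bottleneck
   at least [th] can only use gates of query [q], since later queries have
   smaller weights and the gates of earlier ones have been removed. *)
Lemma path_triangle T q h p : q < n -> h < 12 * n -> slot_pass h = 1 ->
  q * (12 * n) + h <= T ->
  path (fun x y => slot_level q h <= weight T x y) 0 p -> last 0 p %/ n = 11 ->
  exists i j k, [/\ i < n, j < n, k < n & triangle q i j k].
Proof.
move=> qn hn pass1 hT; have [_ gn d2 rn en] := slot_bounds hn.
set th := slot_level q h; have th0 : 0 < th by apply: level_gt0.
have thE : th + (q * n + (slot_role h == 0) * slot_elem h) = n * n.
  rewrite /th /slot_level /level subnK //.
  by case: (_ == 0) => /=; nia.
move=> pth; rewrite (path_block th0 pth) div0n add0n => sz.
have thlow : n * n < th + q.+1 * n.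
  by case: (_ == 0) thE => /=; rewrite mulSn; lia.
have hT' : q * (12 * n) <= T by lia.
have hE : h = 6 * n + ((slot_role h * n + slot_elem h) * 2 + slot_side h).
  by rewrite {1}(slotE h) pass1 mul1n.
(* A surviving gate of query [q] has bit one because pass 0 is over. In role 0, its weight bounds
   its index by [slot_elem h] from above, and its expiry bounds it from below. *)
have alive l i j : dynamic l -> i < n -> j < n -> th <= layer_weight T l i j ->
    [/\ gate_query l i j = q, bit q (gate_bit l i j)
      & role l = 0 -> elem l i j = slot_elem h].
  move=> dl ilt jlt le_th.
  have [gq Tle el] := alive_gate qn dl ilt jlt hT' thlow th0 le_th.
  have bE : bit q (gate_bit l i j).
    move: Tle; rewrite /expiry gq; case: bit => //=; rewrite mul0n add0n.
    have := gate_bit_lt l ilt jlt; move: (gate_bit l i j) => g g3.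
    by case: (_ == 0) => /=; lia.
  split=> // r0; move: el Tle; rewrite /expiry gq bE /gate_bit r0 /= => el.
  have [elt _] := elem_shuttle_lt l ilt jlt.
  move: hE thE; case: (slot_role h) => [|r] /= hE thE Tle.
    by case: (l %% 3 == 0) Tle => /=; lia.
  (* Slots of roles 1 and 2 come after all slots of role 0, so no gate of role 0 would be left. *)
  by case: (l %% 3 == 0) Tle => /=; rewrite mulSn in hE *; lia.
have down l i j : dynamic l -> i < n -> j < n -> l %% 3 == 1 ->
    gate_query l i j = q -> i = (j + q) %% n.
  move=> dl ilt jlt l1; rewrite /gate_query /shuttle /elem (eqP l1) /= => /eqP.
  by rewrite latin_square // => /eqP.
have up l i j : dynamic l -> i < n -> j < n -> l %% 3 == 0 ->
    gate_query l i j = q -> j = (i + q) %% n.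
  move=> dl ilt jlt l1; rewrite /gate_query /shuttle /elem (eqP l1) /= => /eqP.
  by rewrite latin_square // => /eqP.
(* The vertex [x1] lies in block 1, [x2] in block 2, and so on; layer [l] is the edge that leaves
   block [l]. *)
case: p pth sz => [|x1 [|x2 [|x3 [|x4 [|x5 [|x6 [|x7 [|x8 [|x9 [|x10 [|x11 [|]]]]]]]]]]]] //=.
rewrite andbT => /and5P[/(weight_edge th0)[]]; rewrite div0n => b1 _.
move=> /(weight_edge th0)[]; rewrite b1 => b2 w1.
move=> /(weight_edge th0)[]; rewrite b2 => b3 w2.
move=> /(weight_edge th0)[]; rewrite b3 => b4 w3.
move=> /and5P[/(weight_edge th0)[]]; rewrite b4 => b5 w4.
move=> /(weight_edge th0)[]; rewrite b5 => b6 w5.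
move=> /(weight_edge th0)[]; rewrite b6 => b7 w6.
move=> /(weight_edge th0)[]; rewrite b7 => b8 w7.
move=> /and3P[/(weight_edge th0)[]]; rewrite b8 => b9 w8.
move=> /(weight_edge th0)[]; rewrite b9 => b10 w9 _ _.
have m x : x %% n < n by rewrite ltn_mod.
have [q1 u1 r1] := alive 1 _ _ isT (m _) (m _) w1.
have [q3 u3 _] := alive 3 _ _ isT (m _) (m _) w3.
have [q4 u4 _] := alive 4 _ _ isT (m _) (m _) w4.
have [q6 u6 _] := alive 6 _ _ isT (m _) (m _) w6.
have [q7 u7 _] := alive 7 _ _ isT (m _) (m _) w7.
have [q9 u9 r9] := alive 9 _ _ isT (m _) (m _) w9.
(* For a fixed query a shuttle determines its element, so the elements on the two sides of one
   shuttle agree. *)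
have inj x y : (x %% n + q) %% n = (y %% n + q) %% n -> x %% n = y %% n.
  by move/eqP; rewrite eqn_modDr !modn_mod => /eqP.
have x53 : x5 %% n = x3 %% n.
  by apply: inj; rewrite -(down 4 _ _ isT (m x4) (m x5) isT q4); exact: up q3.
have x86 : x8 %% n = x6 %% n.
  by apply: inj; rewrite -(down 7 _ _ isT (m x7) (m x8) isT q7); exact: up q6.
(* No shuttle joins these two blocks; the indices agree because weight and expiry force both to be
   [slot_elem h]. *)
have x92 : x9 %% n = x2 %% n by exact: etrans (r9 erefl) (esym (r1 erefl)).
exists (x2 %% n), (x3 %% n), (x6 %% n); split; rewrite ?ltn_mod //.
rewrite /triangle.
apply/and5P; split.
- by move: u1; rewrite /gate_bit mul0n.
- by move: u3; rewrite /gate_bit mul1n.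
- exact: u6.
- exact: adjacency_edge w2.
- have := adjacency_edge th0 _ w5; rewrite x53 => -> //.
  by have := adjacency_edge th0 _ w8; rewrite x86 x92 => ->.
Qed.

(* The gates of the triangle are the 2-paths through the shuttles that the
   Latin square assigns to query [q]. *)
Lemma triangle_path q i j k : q < n -> i < n -> j < n -> k < n ->
  triangle q i j k ->
  exists p, [/\ path (fun x y => slot_level q (6 * n + 2 * i) <=
                  weight (q * (12 * n) + (6 * n + 2 * i)) x y) 0 p,
    last 0 p = 11 * n, uniq (0 :: p), all (gtn (12 * n)) p & p != [::]].
Proof.
move=> qn ilt jlt klt /and5P[ui vj wk aij /andP[ajk aki]].
(* In pass 1, [h] is the slot of the layer 1 gate of [i], the first of its two gates to go; at time
   [T] both are still present. *)
set h := 6 * n + 2 * i; set T := q * _ + h; set th := slot_level q h.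
have thE : th = level q 0 i.
  rewrite /th /slot_level.
  have gE : slot_gate h = i.
    by rewrite /slot_gate /h addnC modnDr modn_small ?mulKn //; lia.
  by rewrite /slot_role /slot_elem gE divn_small // modn_small.
pose c r := (r + q) %% n; have clt r : c r < n by rewrite ltn_mod.
pose p := [:: 1 * n + c i; 2 * n + i; 3 * n + j; 4 * n + c j; 5 * n + j;
  6 * n + k; 7 * n + c k; 8 * n + k; 9 * n + i; 10 * n + c i; 11 * n + 0].
have E l x y : x < n -> y < n -> th <= layer_weight T l x y ->
    th <= weight T (l * n + x) (l.+1 * n + y).
  by move=> xn yn le; rewrite /weight !(divMD, modMD) // eqxx mul1n.
have thW : th <= n * n by rewrite thE; exact: level_le.
(* In role 0 the index is [i] itself. The one-bit gates of the other roles are deleted later and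
   have the highest weight of the query. *)
have gate l r : r < n -> dynamic l -> bit q (role l * n + r) ->
    (role l = 0 -> r = i) ->
    th <= layer_weight T l (if l %% 3 == 0 then r else c r)
                           (if l %% 3 == 0 then c r else r).
  move=> rn dl br r0; rewrite /layer_weight dl (negPf (proj1 (andP dl))).
  set x := if _ then r else _; set y := if _ then c r else _.
  have eE : elem l x y = r by rewrite /elem /x /y; case: (l %% 3 == 0).
  have qE : gate_query l x y = q.
    apply/eqP; rewrite /gate_query eE.
    have -> : shuttle l x y = c r by rewrite /shuttle /x /y; case: (l %% 3 == 0).
    by rewrite latin_square.
  rewrite /expiry /gate_bit qE eE br /level thE.
  have -> : T <= q * (12 * n) + (1 * (6 * n) + ((role l * n + r) * 2 + (l %% 3 == 0))).
    rewrite /T /h; have : i <= role l * n + r; last by lia.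
    by case: (role l) r0 => [-> //|s _]; rewrite mulSn; lia.
  rewrite mul1n /level eqxx mul1n; apply: leq_sub2l; rewrite leq_add2l.
  by case: eqP => [/r0->|_]; rewrite ?mul1n ?mul0n.
have adj l x y : l %% 3 == 2 -> a x y -> th <= layer_weight T l x y.
  by move=> l2 axy; rewrite /layer_weight l2 axy mul1n.
exists p; split=> //.
- have := E 0 0 (c i) n_gt0 (clt i) thW; rewrite /p /= => ->.
  rewrite (E 1 (c i) i) ?(gate 1 i) // (E 2 i j) ?(adj 2) //.
  rewrite (E 3 j (c j)) ?(gate 3 j) // ?mul1n // (E 4 (c j) j) ?(gate 4 j) // ?mul1n //.
  rewrite (E 5 j k) ?(adj 5) //.
  rewrite (E 6 k (c k)) ?(gate 6 k) // (E 7 (c k) k) ?(gate 7 k) //.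
  rewrite (E 8 k i) ?(adj 8) // (E 9 i (c i)) ?(gate 9 i) // (E 10 (c i) 0) //.
- by rewrite /= addn0.
- apply: (@map_uniq _ _ (fun x => x %/ n)).
  by rewrite /= div0n !divMD.
  have := clt i; have := clt j; have := clt k;
 by rewrite /p /= !andbT => *; do ! (apply/andP; split); lia.
Qed.

End Gadget.

(** * Bottlenecks and thresholds *)

Lemma leq_foldr_minn th z ws :
  (th <= foldr minn z ws) = (th <= z) && all (leq th) ws.
Proof.
by elim: ws => [|w ws IH] /=; rewrite ?andbT // leq_min IH andbCA.
Qed.

Lemma bottleneck_path n (G : 'M[nat]_n) s p th : th <= bottleneck G s p ->
  path (fun x y => th <= G x y) s p.
Proof.
rewrite /bottleneck leq_foldr_minn => /andP[_].
by elim: p s => //= y p IH s /andP[-> /IH].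
Qed.

Lemma path_bottleneck n (G : 'M[nat]_n) s p th : p != [::] ->
  path (fun x y => th <= G x y) s p -> th <= bottleneck G s p.
Proof.
move=> p0 pth; rewrite /bottleneck leq_foldr_minn.
have -> : all (leq th) (pairmap (fun x y => G x y) s p).
  by elim: p s pth {p0} => //= y p IH s /andP[-> /IH].
by case: p p0 pth => //= y p _ /andP[->].
Qed.

(** * The update schedule *)

Definition update_ok (inc : bool) :
  forall n W : nat, 'M[nat]_n -> update n -> bool :=
  if inc then insertion else deletion.

Section Schedule.
Variables (n : nat) (a : rel nat) (bit : nat -> nat -> bool) (inc : bool).
Hypothesis n_gt0 : 0 < n.

Lemma nodes_gt0 : 0 < 12 * n. Proof. by rewrite muln_gt0. Qed.

Definition node (x : nat) : 'I_(12 * n) := insubd (Ordinal nodes_gt0) x.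

Lemma val_node x : x < 12 * n -> node x = x :> nat.
Proof. by move=> lt; rewrite /node val_insubd lt. Qed.

Definition graph (T : nat) : 'M[nat]_(12 * n) := \matrix_(x, y) weight n a bit T x y.

Definition source : 'I_(12 * n) := node 0.
Definition target : 'I_(12 * n) := node (11 * n).

Lemma source_neq_target : source != target.
Proof. by rewrite -val_eqE /= !val_node //; lia. Qed.

Lemma stBP_sound T q h b : q < n -> h < 12 * n -> slot_pass n h = 1 ->
  q * (12 * n) + h <= T -> stBP_value (graph T) source target b ->
  slot_level n q h <= b ->
  exists i j k, [/\ i < n, j < n, k < n & triangle n a bit q i j k].
Proof.
move=> qn hn pass1 hT [_ val] le_b.
have th0 : 0 < slot_level n q h.
  by have [_ _ _ _ ?] := slot_bounds n_gt0 hn; apply: level_gt0.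
case: val => [[p /and3P[_ /eqP lastp _] bE]|[_ b0]]; last by lia.
rewrite -bE in le_b; have := bottleneck_path le_b.
have w x y : graph T x y = weight n a bit T (val x) (val y) by rewrite mxE.
rewrite (eq_path (e' := relpre val (fun x y => slot_level n q h <= weight n a bit T x y)));
  last by move=> x y; rewrite /= w.
rewrite -path_map /= val_node ?muln_gt0 // => pth.
apply: path_triangle pth _ => //.
by rewrite -{1}(val_node nodes_gt0) last_map lastp /= val_node ?mulnK //; lia.
Qed.

Lemma stBP_complete q i j k b : q < n -> i < n -> j < n -> k < n ->
  triangle n a bit q i j k ->
  stBP_value (graph (q * (12 * n) + (6 * n + 2 * i))) source target b ->
  slot_level n q (6 * n + 2 * i) <= b.
Proof.
move=> qn ilt jlt klt tri; set T := _ + _; set h := 6 * n + _ => -[ub _].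
have [p [pth lastp up allp pn]] := triangle_path n_gt0 qn ilt jlt klt tri.
have hn : h < 12 * n by rewrite /h; lia.
have th0 : 0 < slot_level n q h.
  by have [_ _ _ _ ?] := slot_bounds n_gt0 hn; apply: level_gt0.
have vp : map val (map node p) = p.
  rewrite -map_comp; apply: map_id_in => x /(allP allp); exact: val_node.
have s0 : 0 = val source by rewrite /= val_node // nodes_gt0.
have pth' : path (fun x y => slot_level n q h <= graph T x y) source (map node p).
  have pth' : path (relpre val (fun x y => slot_level n q h <= weight n a bit T x y))
                source (map node p) by rewrite -path_map vp -s0.
  by apply: (sub_path _ pth') => x y; rewrite /= mxE.
apply: leq_trans (path_bottleneck _ pth') (ub _ _); first by case: (p) pn.
apply/and3P; split.
- by apply: (sub_path _ pth') => x y; rewrite /edge; apply: leq_trans.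
- by rewrite -val_eqE -last_map vp -s0 lastp /= val_node //; lia.
- by rewrite -(map_inj_uniq val_inj) /= vp val_node ?nodes_gt0.
Qed.

(** Weights reach [n * n]; this is the source of the exponent 2 in the weight range. *)
Lemma wdigraph_graph c T : 1 < c -> wdigraph ((12 * n) ^ c) (graph T).
Proof.
move=> c1 x y; rewrite !mxE weight_diag //; split=> //.
apply: (@leq_trans (n * n)); first exact: weight_le.
apply: (@leq_trans ((12 * n) ^ 2)); first by rewrite expnS expn1; nia.
by rewrite leq_pexp2l ?muln_gt0.
Qed.

Definition slots : nat := n * (12 * n).

(** In the incremental case time runs backwards: step [S] undoes slot [slots - S.+1], leading from
    the graph after that slot to the graph before it. *)
Definition slot_time (S : nat) : nat := if inc then slots - S.+1 else S.

Definition state (S : nat) : 'M[nat]_(12 * n) :=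
  graph (if inc then slots - S else S).

Definition slot_update (S : nat) : option (update (12 * n)) :=
  let q := slot_time S %/ (12 * n) in let h := slot_time S %% (12 * n) in
  if active n bit q h then
    Some (node (slot_source n q h), node (slot_target n q h),
          if inc then slot_level n q h else 0)
  else None.

Definition updates_from (S : nat) : seq (update (12 * n)) :=
  pmap slot_update (iota S (slots - S)).

Lemma slot_time_lt S : S < slots -> slot_time S < slots.
Proof. by rewrite /slot_time; case: inc => //; lia. Qed.

Lemma slot_timeE T : T < slots ->
  [/\ T %/ (12 * n) < n, T %% (12 * n) < 12 * n
    & T = T %/ (12 * n) * (12 * n) + T %% (12 * n)].
Proof.
by move=> lt; rewrite -divn_eq ltn_mod ltn_divLR ?nodes_gt0.
Qed.

Lemma eq_node (x : 'I_(12 * n)) z : z < 12 * n -> (x == node z) = (val x == z).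
Proof. by move=> lt; rewrite -val_eqE /= val_node. Qed.

Lemma state_step S : S < slots ->
  state S.+1 = if slot_update S is Some u then apply_update (state S) u
               else state S.
Proof.
move=> /[dup] ltS /slot_time_lt ltT; rewrite /slot_update /=.
case: (slot_timeE ltT); move: (_ %/ _) (_ %% _) => q h qn hn TE.
have [sn tn] : slot_source n q h < 12 * n /\ slot_target n q h < 12 * n.
  by split; [apply: slot_source_lt|apply: slot_target_lt].
have step x y := weight_step a bit n_gt0 x y qn hn.
have at_slot T' (act : active n bit q h) := weight_slot a n_gt0 T' qn hn act.
move: TE step at_slot; rewrite /= /slot_time /state.
case: (inc) ltS => ltS TE step at_slot.
- have SE : slots - S = (slots - S.+1).+1 by lia.
  rewrite SE TE.
  case: ifP => act; last first.
    by apply/matrixP=> x y; rewrite !mxE step act.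
  apply/matrixP=> x y; rewrite !mxE !eq_node // step act /=.
  case: andP => // -[/eqP-> /eqP->].
  by rewrite at_slot // leqnn mul1n.
- rewrite TE; case: ifP => act; last first.
    by apply/matrixP=> x y; rewrite !mxE step act.
  by apply/matrixP=> x y; rewrite !mxE !eq_node // step act.
Qed.

Lemma slot_update_ok c S u : 1 < c -> S < slots -> slot_update S = Some u ->
  update_ok inc ((12 * n) ^ c) (state S) u.
Proof.
move=> c1 /[dup] ltS /slot_time_lt ltT; rewrite /slot_update /=.
case: (slot_timeE ltT); move: (_ %/ _) (_ %% _) => q h qn hn TE.
have [sn tn] : slot_source n q h < 12 * n /\ slot_target n q h < 12 * n.
  by split; [apply: slot_source_lt|apply: slot_target_lt].
case: ifP => // act [<-].
have at_slot T' := weight_slot a n_gt0 T' qn hn act.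
have lv0 : 0 < slot_level n q h.
  by have [_ _ _ _ ?] := slot_bounds n_gt0 hn; apply: level_gt0.
have W T' : weight n a bit T' (slot_source n q h) (slot_target n q h) <= (12 * n) ^ c.
  apply: (@leq_trans (n * n)); first exact: weight_le.
  apply: (@leq_trans ((12 * n) ^ 2)); first by rewrite expnS expn1; nia.
  by rewrite leq_pexp2l ?muln_gt0.
move: TE; rewrite /slot_time /state.
case: (inc) ltS => ltS TE; rewrite /= /edge mxE !val_node // at_slot -TE.
- have -> : slots - S = (slots - S.+1).+1 by lia.
  rewrite ltnn lv0 /=; apply/andP; split.
    rewrite eq_node // /= val_node //; apply/eqP=> e.
    have [b1 _ b2 _] := slot_ends n_gt0 q hn.
    by move: b2; rewrite -e b1; lia.
  by have := W 0; rewrite at_slot mul1n.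
- by rewrite leqnn mul1n lv0.
Qed.

Lemma updates_fromE S : S < slots ->
  updates_from S = oapp (cons^~ (updates_from S.+1)) (updates_from S.+1) (slot_update S).
Proof.
move=> ltS; rewrite /updates_from; have -> : slots - S = (slots - S.+1).+1 by lia.
by rewrite /=; case: slot_update.
Qed.

Lemma updates_legal c S : 1 < c -> S <= slots ->
  legal (@update_ok inc (12 * n) ((12 * n) ^ c)) (state S) (updates_from S).
Proof.
move=> c1 leS; have [d dE] : exists d, slots = S + d by exists (slots - S); lia.
elim: d => [|d IH] in S leS dE *.
  by rewrite /updates_from (_ : slots - S = 0) //; lia.
have ltS : S < slots by lia.
rewrite updates_fromE //; case uE: (slot_update S) => [u|] /=.
  rewrite (slot_update_ok c1 ltS uE) /=.
  by have := state_step ltS; rewrite uE => <-; apply: IH; lia.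
by have := state_step ltS; rewrite uE => <-; apply: IH; lia.
Qed.

(** Slots [h] and [h + 6 * n] handle the same gate edge in the two passes, and its bit makes exactly
    one of them active. *)
Lemma sum_active q : \sum_(0 <= h < 12 * n) active n bit q h = 6 * n.
Proof.
rewrite (@big_cat_nat _ _ _ (6 * n)) //=; last by lia.
rewrite -{2}[6 * n]add0n big_addn (_ : 12 * n - 6 * n = 6 * n); last by lia.
rewrite -big_split /= -[RHS]muln1 -[6 * n in RHS]subn0 -sum_nat_const_nat.
rewrite [LHS]big_nat [RHS]big_nat; apply: eq_bigr => h /= hn.
rewrite /active /slot_gate /slot_pass modnDr divnDr // divnn.
rewrite (divn_small hn) (_ : 0 < 6 * n) ?muln_gt0 //.
by case: (bit _ _).
Qed.

(** As every update takes at least one step, this allows the quadratic overhead of the reduction to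
    be charged to the dynamic algorithm. *)
Lemma updates_size : n * n <= size (updates_from 0).
Proof.
pose act T := active n bit (T %/ (12 * n)) (T %% (12 * n)).
have -> : size (updates_from 0) = \sum_(0 <= S < slots) act (slot_time S).
  rewrite size_pmap -sum1_count /index_iota big_mkcond /=.
  by apply: eq_bigr => S _; rewrite /slot_update /act /=; case: (active _ _ _ _).
have -> : \sum_(0 <= S < slots) act (slot_time S) = \sum_(0 <= T < slots) act T.
  rewrite /slot_time; case: (inc) => //.
  by rewrite [RHS]big_nat_rev.
suff -> : forall m, \sum_(0 <= T < m * (12 * n)) act T = m * (6 * n) by nia.
elim=> [|m IH]; first by rewrite mul0n big_geq.
rewrite (@big_cat_nat _ _ _ (m * (12 * n))) //=; last by rewrite leq_mul2r leqnSn orbT.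
rewrite IH [m.+1 * (6 * n)]mulSnr; congr (_ + _).
rewrite -{1}[m * (12 * n)]add0n big_addn mulSn addnK -(sum_active m).
rewrite [LHS]big_nat [RHS]big_nat; apply: eq_bigr => h /= hn.
by rewrite /act addnC divMD // modMD.
Qed.

End Schedule.

(** * The programs of the reduction *)

(* Register i is the word at address i of array 1: 0 is the answer, 1 is n,
   2 the number of queries answered, 3 a loop counter, 4 and 5 the query index
   and the slot in the time order of the decremental schedule. *)
Definition reg (i : nat) : expr := Read 1 (Const i).
Definition set_reg (i : nat) (e : expr) : prog := Write 1 (Const i) e.

Declare Scope prog_scope.
Notation "e1 +' e2" := (Bin OpAdd e1 e2) (at level 50, left associativity) : prog_scope.
Notation "e1 -' e2" := (Bin OpSub e1 e2) (at level 50, left associativity) : prog_scope.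
Notation "e1 *' e2" := (Bin OpMul e1 e2) (at level 40, left associativity) : prog_scope.
Notation "e1 /' e2" := (Bin OpDiv e1 e2) (at level 40, left associativity) : prog_scope.
Notation "e1 %' e2" := (Bin OpMod e1 e2) (at level 40, left associativity) : prog_scope.
Notation "e1 ==' e2" := (Bin OpEq e1 e2) (at level 70) : prog_scope.
Notation "e1 <' e2" := (Bin OpLt e1 e2) (at level 70) : prog_scope.
Notation "p1 ;; p2" := (Seq p1 p2) (at level 100, right associativity) : prog_scope.
Local Open Scope prog_scope.
Coercion Const : nat >-> expr.

Definition nE := reg 1.
Definition passE := reg 5 /' (6 *' nE).
Definition gateE := (reg 5 %' (6 *' nE)) /' 2.
Definition sideE := (reg 5 %' (6 *' nE)) %' 2.
Definition roleE := gateE /' nE.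
Definition elemE := gateE %' nE.
Definition shuttleE := (elemE +' reg 4) %' nE.
Definition layerE :=
  3 *' roleE +' ((1 -' sideE) +' 9 *' (sideE *' (roleE ==' 0))).
Definition tailE := sideE *' elemE +' (1 -' sideE) *' shuttleE.
Definition headE := sideE *' shuttleE +' (1 -' sideE) *' elemE.
Definition levelE := nE *' nE -' (reg 4 *' nE +' (roleE ==' 0) *' elemE).
Definition sourceE := layerE *' nE +' tailE.
Definition targetE := (layerE +' 1) *' nE +' headE.
Definition activeE := Read 0 gateE ==' passE.

Definition check_prog : prog :=
  set_reg 0 (0 <' (reg 0 +' passE *' (levelE <' (Read 3 0 +' 1)))).

Definition update_prog (inc : bool) (p : prog) : prog :=
  Write 2 0 sourceE;; Write 2 1 targetE;;
  Write 2 2 (if inc then levelE else 0);; shift_prog p.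

(** The check runs on both sides of the update: completeness uses the value before a deletion or
    after an insertion, and soundness holds for both values. *)
Definition slot_prog (inc : bool) (p : prog) : prog :=
  set_reg 5 (if inc then 12 *' nE -' (reg 3 +' 1) else reg 3);;
  check_prog;;
  If activeE (update_prog inc p) Skip;;
  check_prog;;
  set_reg 3 (reg 3 +' 1).

Definition loopE := reg 3 <' 12 *' nE.

Definition query_prog (inc : bool) (p : prog) : prog :=
  set_reg 0 0;; set_reg 3 0;;
  set_reg 4 (if inc then nE -' (reg 2 +' 1) else reg 2);;
  While loopE (slot_prog inc p);;
  set_reg 2 (reg 2 +' 1).

(* The loop of [init_prog] writes the entry of row [rowE] and column [colE] of
   the initial weight matrix, whose row-major position is in register 3. *)
Definition sizeE := 12 *' nE.
Definition rowE := reg 3 /' sizeE.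
Definition colE := reg 3 %' sizeE.
Definition lE := rowE /' nE.
Definition iE := rowE %' nE.
Definition jE := colE %' nE.
Definition upE := lE %' 3 ==' 0.
Definition relemE := upE *' iE +' (1 -' upE) *' jE.
Definition rshuttleE := upE *' jE +' (1 -' upE) *' iE.
Definition rroleE := (lE /' 3) %' 3.
Definition rqueryE := (rshuttleE +' nE -' relemE) %' nE.
Definition rlevelE := nE *' nE -' (rqueryE *' nE +' (rroleE ==' 0) *' relemE).
Definition staticE := (lE ==' 0) +' (lE ==' 10).
Definition weightE (inc : bool) :=
  (colE /' nE ==' lE +' 1) *'
  ((lE %' 3 ==' 2) *' (Read 0 (1 +' (iE *' nE +' jE)) *' (nE *' nE)) +'
   (1 -' (lE %' 3 ==' 2)) *'
     (staticE *' (nE *' nE) +'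
      (1 -' staticE) *' ((if inc then 0 else 1) *' rlevelE))).

Definition init_prog (inc : bool) (p : prog) : prog :=
  set_reg 1 (Read 0 0);;
  Write 2 0 sizeE;; Write 2 2 (11 *' nE);;
  While (reg 3 <' sizeE *' sizeE)
    (Write 2 (reg 3 +' 3) (weightE inc);; set_reg 3 (reg 3 +' 1));;
  shift_prog p.

Definition OMv3_algorithm (inc : bool) (alg : algorithm) : algorithm :=
  Algorithm (init_prog inc (preprocess alg)) (query_prog inc (serve alg)).

(** A condition decided by computation that gives [safe]: reads are confined to the input, the six
    registers and the simulated answer, all kept at most [B] by [bounded]. *)
Fixpoint simple (e : expr) : bool :=
  match e with
  | Const x => x <= 12
  | Read 0 e1 => simple e1
  | Read 1 (Const i) => i < 6
  | Read 3 (Const 0) => true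
  | Read _ _ => false
  | Bin o e1 e2 => [&& tame o, simple e1 & simple e2]
  end.

Definition bounded (B : nat) (M : memory) : Prop :=
  [/\ forall i, M 0 i <= B, forall i, i < 6 -> M 1 i <= B & M 3 0 <= B].

Lemma simple_safe B M e : 12 <= B -> bounded B M -> simple e -> safe B M e.
Proof.
move=> B12 [M0 M1 M3]; elim: e => [x|arr e IH|o e1 IH1 e2 IH2] /=.
- by move=> /leq_trans->.
- case: arr IH => [|[|[|[|arr]]]] // IH.
  + by move=> /IH; split.
  + by case: e {IH} => //= i i6; split; [lia|exact: M1].
  + by case: e {IH} => //= -[|i] //.
- by case/and3P=> to /IH1 ? /IH2.
Qed.

(** A generous bound on the degrees of all expressions in the programs; it affects only the constant
    exponent of the word size. *)
Definition max_deg : nat := 1000.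

Section Exec.
Variables (B b : nat).
Hypotheses (B12 : 12 <= B) (leb : B ^ max_deg <= b).

Definition fits (e : expr) : bool := simple e && (deg e <= max_deg).

Lemma eval_fits M e : bounded B M -> fits e -> eval b M e = Some (den M e).
Proof.
move=> bM /andP[s d]; apply: (@eval_safe B); first by lia.
  exact: simple_safe.
by apply: leq_trans leb; rewrite leq_pexp2l //; lia.
Qed.

Lemma exec_write M arr e1 e2 : bounded B M -> fits e1 -> fits e2 ->
  exec b (Write arr e1 e2) M (cost e1 + cost e2).+1
    (mem_upd M arr (den M e1) (den M e2)).
Proof. by move=> bM f1 f2; apply: ExecWrite; apply: eval_fits. Qed.

Lemma bounded_reg M i x : bounded B M -> x <= B -> bounded B (mem_upd M 1 i x).
Proof.
case=> [M0 M1 M3] xB; split=> [j|j j6|]; [exact: M0| |exact: M3].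
by rewrite /mem_upd; case: (_ && _) => //; exact: M1.
Qed.

End Exec.

(** * Serving one query *)

Lemma foldr_minn_le z ws : foldr minn z ws <= z.
Proof. by elim: ws => //= w ws IH; rewrite geq_min IH orbT. Qed.

Lemma stBP_value_le n (G : 'M[nat]_n) s t v W :
  (forall x y, G x y <= W) -> stBP_value G s t v -> v <= W.
Proof.
move=> GW [_ [[p _ <-]|[_ ->//]]]; apply: leq_trans (foldr_minn_le _ _) _.
by case: p => //= y p; exact: GW.
Qed.

Definition check (n q h ans : nat) : bool :=
  (slot_pass n h == 1) && (slot_level n q h <= ans).

Definition regs (M : memory) (acc n t h q eta : nat) : Prop :=
  [/\ M 1 0 = acc, M 1 1 = n & M 1 2 = t] /\
  [/\ M 1 3 = h, M 1 4 = q & M 1 5 = eta].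

Lemma den_source M : den M sourceE = slot_source (M 1 1) (M 1 4) (M 1 5).
Proof. by []. Qed.

Lemma den_target M : den M targetE = slot_target (M 1 1) (M 1 4) (M 1 5).
Proof. by rewrite /slot_target -addn1. Qed.

Lemma den_level M : den M levelE = slot_level (M 1 1) (M 1 4) (M 1 5).
Proof. by []. Qed.

Section Simulation.
Variables (n : nat) (a : rel nat) (bit : nat -> nat -> bool) (inc : bool).
Variables (B b b0 : nat) (p : prog).
Hypotheses (n_gt0 : 0 < n) (B12 : 12 <= B) (leB : 12 * n <= B) (leB2 : n * n <= B).
Hypotheses (leb : B ^ max_deg <= b) (leb0 : b0 <= b).

Lemma fits_slot : [/\ fits sourceE, fits targetE, fits levelE & fits activeE].
Proof. by rewrite /fits; split; vm_compute. Qed.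

Lemma fits_check : fits (0 <' (reg 0 +' passE *' (levelE <' (Read 3 0 +' 1)))).
Proof. by rewrite /fits; vm_compute. Qed.

Lemma fits_const i : i <= 12 -> fits (Const i).
Proof. by move=> i12; rewrite /fits /= i12. Qed.

Lemma exec_set M i e : bounded B M -> i <= 12 -> fits e ->
  exec b (set_reg i e) M (cost e).+2 (mem_upd M 1 i (den M e)).
Proof.
by move=> bM i12 fe; have := exec_write B12 leb 1 bM (fits_const i12) fe.
Qed.

Lemma exec_check M (acc : bool) t h q eta : bounded B M ->
  eta < 12 * n -> regs M acc n t h q eta ->
  exec b check_prog M 
    (cost (0 <' (reg 0 +' passE *' (levelE <' (Read 3 0 +' 1))))).+2
    (mem_upd M 1 0 (acc || check n q eta (M 3 0))).
Proof.
move=> bM lt [[R0 R1 R2] [R3 R4 R5]]; have := exec_set bM (isT : 0 <= 12) fits_check.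
suff -> : den M (0 <' (reg 0 +' passE *' (levelE <' (Read 3 0 +' 1)))) =
  (acc || check n q eta (M 3 0)) by [].
rewrite [LHS]/(nat_of_bool (0 < M 1 0 + slot_pass (M 1 1) (M 1 5) *
  (slot_level (M 1 1) (M 1 4) (M 1 5) < M 3 0 + 1))).
rewrite R0 R1 R4 R5 addn1 ltnS /check.
have [p2 _ _ _ _] := slot_bounds n_gt0 lt.
move: (slot_level _ _ _ <= _) => c.
by case: acc {R0}; case: (slot_pass n eta) p2 => [|[|]] // _; case: c.
Qed.

Lemma simulates_request M m x y w : simulates M m ->
  simulates (mem_upd (mem_upd (mem_upd M 2 0 x) 2 1 y) 2 2 w)
            (mem_input m [:: x; y; w]).
Proof.
move=> sim arr i; rewrite /mem_upd /mem_input -sim.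
by case: arr => [|arr] //=; case: i => [|[|[|i]]].
Qed.

Definition request_updates S : seq request :=
  stBP_updates (source n_gt0) (target n_gt0) (state n a bit inc S)
    (updates_from bit inc n_gt0 S).

Definition value S v := stBP_value (state n a bit inc S) (source n_gt0) (target n_gt0) v.

(** The programs compute with the simulated answer, so it has to be small; being correct, it is at
    most the largest weight. *)
Lemma value_le S v : value S v -> v <= B.
Proof.
move=> val; apply: leq_trans leB2; apply: stBP_value_le val => x y.
by rewrite mxE; exact: weight_le.
Qed.

Definition update_cost : nat :=
  cost sourceE + cost targetE + cost levelE + 6 + cost activeE + 3.

Definition query_index (t : nat) : nat := if inc then n - t.+1 else t.
Definition slot_index (h : nat) : nat := if inc then 12 * n - h.+1 else h.

(** Reversing the schedule reverses the order of the queries and the slots within each. A query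
    therefore still occupies consecutive steps, which can be produced when it arrives. *)
Lemma slot_time_index t h : t < n -> h < 12 * n ->
  slot_time n inc (t * (12 * n) + h) = query_index t * (12 * n) + slot_index h.
Proof.
rewrite /slot_time /slots /query_index /slot_index; case: inc => // tn hn.
move: (12 * n) hn => L hn.
have -> : n * L = (n - t.+1) * L + t.+1 * L by rewrite -mulnDl subnK.
rewrite [t.+1 * L]mulSn; move: ((n - t.+1) * L) (t * L) => x y; lia.
Qed.

Lemma query_index_lt t : t < n -> query_index t < n.
Proof. by rewrite /query_index; case: inc => //; lia. Qed.

Lemma slot_index_lt h : h < 12 * n -> slot_index h < 12 * n.
Proof. by rewrite /slot_index; case: inc => //; lia. Qed.

(* The simulated algorithm and the simulating one in step: [m] is the memory
   of the former. *)
Definition in_step (M m : memory) (S T : nat) : Prop :=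
  [/\ simulates M m, value S (m 1 0), handles_all b0 p m (request_updates S) T
    & bounded B M].

(** The time bound is amortised: [T] is what the simulated algorithm still spends on the remaining
    requests, and an update moves its share of [T] into [tm]. *)
Lemma exec_update M m acc t h T : t < n -> h < 12 * n ->
  let S := t * (12 * n) + h in let q := query_index t in let eta := slot_index h in
  regs M acc n t h q eta -> (forall g, g < 3 * n -> M 0 g = bit q g) ->
  in_step M m S T ->
  exists tm M' m' T',
  [/\ exec b (If activeE (update_prog inc p) Skip) M tm M',
      regs M' acc n t h q eta, M' 0 =1 M 0, in_step M' m' S.+1 T'
    & tm + T' <= update_cost + T].
Proof.
move=> tn hn S q eta /[dup] R [[R0 R1 R2] [R3 R4 R5]] inp [sim val hdl bM].
have [fs ft fl fa] := fits_slot.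
have qn := query_index_lt tn; have en := slot_index_lt hn.
have ltS : S < slots n by rewrite /S /slots; nia.
have [_ gn _ _ _] := slot_bounds n_gt0 en.
have dact : den M activeE = active n bit q eta.
  rewrite [LHS]/(nat_of_bool (M 0 (slot_gate (M 1 1) (M 1 5)) == slot_pass (M 1 1) (M 1 5))).
  by rewrite R1 R5 inp.
have uE : slot_update bit inc n_gt0 S =
    if active n bit q eta then
      Some (node n_gt0 (slot_source n q eta), node n_gt0 (slot_target n q eta),
            if inc then slot_level n q eta else 0)
    else None.
  by rewrite /slot_update (slot_time_index tn hn) divMD // modMD.
have := state_step a bit inc n_gt0 ltS; have := updates_fromE bit inc n_gt0 ltS.
rewrite uE; have evA := eval_fits B12 leb bM fa; rewrite dact in evA.
case: ifP evA => act evA /= uf st.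
- move: hdl; rewrite /request_updates uf /=; rewrite -st => hdl.
  inversion hdl as [|m0 m1 r rs t1 T1 [ex ans] hdl' e1 e2 e3]; subst.
  move: ex ans => /=; rewrite !val_node; try exact: slot_source_lt;
    try exact: slot_target_lt.
  set x := slot_source _ _ _; set y := slot_target _ _ _; set w := if inc then _ else _.
  move=> ex ans.
  pose M1 := mem_upd (mem_upd (mem_upd M 2 0 x) 2 1 y) 2 2 w.
  have [M' [ex' sim' I0 I1]] := exec_shift (exec_mono leb0 ex) (simulates_request x y w sim).
  have wr e i M2 : i <= 12 -> fits e -> bounded B M2 ->
      exec b (Write 2 (Const i) e) M2 (cost e).+2 (mem_upd M2 2 i (den M2 e)).
    by move=> i12 fe bM2; have := exec_write B12 leb 2 bM2 (fits_const i12) fe.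
  have W1 := wr _ 0 M isT fs bM.
  have xE : den M sourceE = x by rewrite den_source R1 R4 R5.
  have W2 := wr _ 1 (mem_upd M 2 0 x) isT ft bM.
  have yE : den (mem_upd M 2 0 x) targetE = y.
    by rewrite den_target -[LHS]/(slot_target (M 1 1) (M 1 4) (M 1 5)) R1 R4 R5.
  have fw : fits (if inc then levelE else Const 0) by case: (inc).
  have W3 := wr _ 2 (mem_upd (mem_upd M 2 0 x) 2 1 y) isT fw bM.
  have wE : den (mem_upd (mem_upd M 2 0 x) 2 1 y) (if inc then levelE else Const 0) = w.
    rewrite /w; case: (inc) => //.
    by rewrite den_level -[LHS]/(slot_level (M 1 1) (M 1 4) (M 1 5)) R1 R4 R5.
  rewrite xE in W1; rewrite yE in W2; rewrite wE in W3.
  exists (cost activeE + ((cost sourceE).+2 + ((cost targetE).+2 +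
    ((cost (if inc then levelE else Const 0)).+2 + t1)))).+1, M', m1, T1.
  split.
  + apply: ExecIf evA _ => /=.
    exact: ExecSeq W1 (ExecSeq W2 (ExecSeq W3 ex')).
  + by rewrite /regs !I1.
  + by move=> i; rewrite I0.
  + split=> //; split=> [i|i i6|].
    * by rewrite I0; have [M0 _ _] := bM; exact: M0.
    * by rewrite I1; have [_ M1' _] := bM; exact: M1'.
    * by rewrite sim'; exact: value_le ans.
  + have : cost (if inc then levelE else Const 0) <= cost levelE.
      by case: (inc) => //; vm_compute.
    by rewrite /update_cost; lia.
- exists (cost activeE + 1).+1, M, m, T; split=> //.
  + by apply: ExecIf evA _ => /=; apply: ExecSkip.
  + by split=> //; rewrite /value /request_updates ?st // -uf.
  + by rewrite /update_cost; lia.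
Qed.

Definition indexE := if inc then 12 *' nE -' (reg 3 +' 1) else reg 3.
Definition checkE := 0 <' (reg 0 +' passE *' (levelE <' (Read 3 0 +' 1))).
Definition slot_cost : nat :=
  cost indexE + 2 * cost checkE + update_cost + cost (reg 3 +' 1) + 8.

Lemma in_step_reg M m S T i x : x <= B -> in_step M m S T ->
  in_step (mem_upd M 1 i x) m S T.
Proof. by move=> xB [sim val hdl bM]; split=> //; exact: bounded_reg. Qed.

Lemma exec_slot M m (acc : bool) t h eta0 T : t < n -> h < 12 * n ->
  let S := t * (12 * n) + h in let q := query_index t in let eta := slot_index h in
  regs M acc n t h q eta0 -> (forall g, g < 3 * n -> M 0 g = bit q g) ->
  in_step M m S T ->
  exists tm M' m' T' v v',
  [/\ exec b (slot_prog inc p) M tm M',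
      regs M' (acc || check n q eta v || check n q eta v') n t h.+1 q eta,
      M' 0 =1 M 0 /\ in_step M' m' S.+1 T',
      value S v /\ value S.+1 v'
    & tm + T' <= slot_cost + T].
Proof.
move=> tn hn S q eta [[R0 R1 R2] [R3 R4 R5]] inp step.
have en := slot_index_lt hn; have etaB : eta <= B by rewrite /eta; lia.
have bM : bounded B M by case: step.
have fi : fits indexE by rewrite /indexE; case: (inc); vm_compute.
have iE : den M indexE = eta.
  rewrite /indexE /eta /slot_index; case: (inc) => //=; rewrite R3 //.
  by rewrite R1 addn1.
have X1 := exec_set bM (isT : 5 <= 12) fi; rewrite iE in X1.
set M1 := mem_upd M 1 5 eta in X1.
have step1 : in_step M1 m S T by exact: in_step_reg.
have reg1 : regs M1 acc n t h q eta by split; split.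
have X2 := exec_check (let: And4 _ _ _ bM1 := step1 in bM1) en reg1.
set acc2 := acc || _ in X2; set M2 := mem_upd M1 1 0 acc2 in X2.
have b1 (c : bool) : c <= B by case: c; lia.
have step2 : in_step M2 m S T by exact: in_step_reg.
have reg2 : regs M2 acc2 n t h q eta.
  by case: reg1 => -[_ ? ?] [? ? ?]; split; split.
have [tm [M3 [m3 [T3 [X3 reg3 I3 step3 le3]]]]] := exec_update tn hn reg2 inp step2.
have X4 := exec_check (let: And4 _ _ _ bM3 := step3 in bM3) en reg3.
set acc4 := acc2 || _ in X4; set M4 := mem_upd M3 1 0 acc4 in X4.
have step4 : in_step M4 m3 S.+1 T3 by exact: in_step_reg.
have bM4 : bounded B M4 by case: step4.
have X5 := exec_set bM4 (isT : 3 <= 12) (isT : fits (reg 3 +' 1)).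
have hE : den M4 (reg 3 +' 1) = h.+1.
  by case: reg3 => _ [R3' _ _]; rewrite -[LHS]/(M3 1 3 + 1) R3' addn1.
rewrite hE in X5.
do 4 eexists; exists (M 3 0), (M3 3 0); split.
- exact: ExecSeq X1 (ExecSeq X2 (ExecSeq X3 (ExecSeq X4 X5))).
- by case: reg3 => -[_ ? ?] [? ? ?]; split; split.
- by split=> //; apply: in_step_reg step4; lia.
- case: step => sim val _ _; case: step3 => sim3 val3 _ _.
  by rewrite sim sim3.
- by rewrite /slot_cost -/checkE; lia.
Qed.

(** * Correctness of the checks and of a whole query *)

Definition has_triangle (q : nat) : Prop :=
  exists i j k, [/\ i < n, j < n, k < n & triangle n a bit q i j k].

(** In either direction, both graphs adjacent to the slot are taken at a schedule time no earlier
    than the slot, as [stBP_sound] requires. *)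
Lemma check_sound t h v : t < n -> h < 12 * n -> let S := t * (12 * n) + h in
  value S v \/ value S.+1 v ->
  check n (query_index t) (slot_index h) v -> has_triangle (query_index t).
Proof.
move=> tn hn S val /andP[/eqP pass1 lev].
have qn := query_index_lt tn; have en := slot_index_lt hn.
have ltS : S < slots n by rewrite /S /slots; nia.
have TE := slot_time_index tn hn; rewrite -/S /slot_time in TE.
move: val; rewrite /value /state => val.
case: val => [val|val]; apply: (stBP_sound qn en pass1 _ val lev); move: TE;
  case: (inc); lia.
Qed.

(** The graph that still contains the gates of [i] is the one before the slot in schedule time,
    which gives [v] for deletions and [v'] for insertions. *)
Lemma check_complete t h v v' i j k : t < n -> h < 12 * n ->
  let S := t * (12 * n) + h in value S v -> value S.+1 v' ->
  i < n -> j < n -> k < n -> triangle n a bit (query_index t) i j k ->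
  slot_index h = 6 * n + 2 * i ->
  check n (query_index t) (slot_index h) v || check n (query_index t) (slot_index h) v'.
Proof.
move=> tn hn S val val' ilt jlt klt tri hE.
have qn := query_index_lt tn.
have ltS : S < slots n by rewrite /S /slots; nia.
have TE := slot_time_index tn hn; rewrite -/S /slot_time hE in TE.
rewrite hE /check (_ : slot_pass n _ = 1) /=; last first.
  by rewrite /slot_pass -{1}[6 * n]mul1n divMD; lia.
apply/orP; move: TE val val'; rewrite /value /state.
case: (inc) => TE val val'; [right|left].
  by apply: stBP_complete qn ilt jlt klt tri _; rewrite -TE; exact: val'.
by apply: stBP_complete qn ilt jlt klt tri _; rewrite -TE; exact: val.
Qed.

Definition query_indexE := if inc then nE -' (reg 2 +' 1) else reg 2.
Definition query_cost : nat := cost query_indexE + cost loopE + cost (reg 2 +' 1) + 12.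

Lemma exec_query M m t T : t < n -> M 1 1 = n -> M 1 2 = t ->
  let q := query_index t in (forall g, g < 3 * n -> M 0 g = bit q g) ->
  in_step M m (t * (12 * n)) T ->
  exists tm M' m' T' (acc : bool),
  [/\ exec b (query_prog inc p) M tm M',
      [/\ M' 1 0 = acc, M' 1 1 = n & M' 1 2 = t.+1],
      acc <-> has_triangle q,
      in_step M' m' (t.+1 * (12 * n)) T'
    & tm + T' <= query_cost + 12 * n * (slot_cost + cost loopE + 1) + T].
Proof.
move=> tn R1 R2 q inp step.
have bM : bounded B M by case: step.
have qn := query_index_lt tn.
have X1 := exec_set bM (isT : 0 <= 12) (isT : fits (Const 0)).
have step1 : in_step (mem_upd M 1 0 0) m (t * (12 * n)) T by exact: in_step_reg.
have X2 := exec_set (let: And4 _ _ _ c := step1 in c) (isT : 3 <= 12) (isT : fits (Const 0)).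
set M2 := mem_upd (mem_upd M 1 0 0) 1 3 0 in X2.
have step2 : in_step M2 m (t * (12 * n)) T by exact: in_step_reg.
have fq : fits query_indexE by rewrite /query_indexE; case: (inc).
have X3 := exec_set (let: And4 _ _ _ c := step2 in c) (isT : 4 <= 12) fq.
have qE : den M2 query_indexE = q.
  rewrite /query_indexE /q /query_index; case: (inc); last exact: R2.
  by rewrite -[LHS]/(M 1 1 - (M 1 2 + 1)) R1 R2 addn1.
rewrite qE in X3; set M3 := mem_upd M2 1 4 q in X3.
have step3 : in_step M3 m (t * (12 * n)) T by apply: in_step_reg step2; lia.
(* The accumulator is sound throughout, and complete for the indices whose slot has been passed.
   Register 5 holds the leftover [eta] of the previous round. *)
pose I h s M' := exists m' T' (acc : bool) eta,
  [/\ regs M' acc n t h q eta, (forall g, g < 3 * n -> M' 0 g = bit q g),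
      in_step M' m' (t * (12 * n) + h) T',
      s + T' <= h * (slot_cost + cost loopE + 1) + T
    & (acc -> has_triangle q) /\
      (forall i j k, i < n -> j < n -> k < n -> triangle n a bit q i j k ->
         forall h', h' < h -> slot_index h' = 6 * n + 2 * i -> acc)].
have fl : fits loopE by vm_compute.
have loopv M' m' S T' acc h eta : regs M' acc n t h q eta -> in_step M' m' S T' ->
    eval b M' loopE = Some (nat_of_bool (h < 12 * n)).
  move=> [[_ R1' _] [R3' _ _]] [_ _ _ bM'].
  rewrite (eval_fits B12 leb bM' fl) -[den _ _]/(nat_of_bool (M' 1 3 < 12 * M' 1 1)).
  by rewrite R1' R3'.
have [|||tl [sl [M4 [X4 I4 le4]]]] := @exec_count b loopE (slot_prog inc p) I (12 * n) _ _ 0 0 M3 isT.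
- move=> h s M' hn [m' [T' [acc [eta [reg' inp' step' le' [snd cpl]]]]]].
  split; first by rewrite (loopv _ _ _ _ _ _ _ reg' step') hn.
  have [tm [M5 [m5 [T5 [v [v' [X5 reg5 [I5 step5] [val val'] le5]]]]]]] :=
    exec_slot tn hn reg' inp' step'.
  exists tm, M5; split=> //; exists m5, T5, (acc || check n q (slot_index h) v || check n q (slot_index h) v'), (slot_index h).
  split=> //.
  + by move=> g g3; rewrite I5 inp'.
  + by rewrite addnS.
  + by rewrite mulSn; lia.
  + split=> [|i j k ilt jlt klt tri h'].
      case/orP=> [/orP[|]|]; first exact: snd.
        by apply: check_sound => //; left.
      by apply: check_sound => //; right.
    rewrite ltnS leq_eqVlt => /orP[/eqP->|lt] hE.
      by rewrite -orbA (check_complete tn hn val val' ilt jlt klt tri hE) orbT.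
    by rewrite (cpl i j k ilt jlt klt tri h' lt hE).
- move=> s M' [m' [T' [acc [eta [reg' _ step' _ _]]]]].
  by rewrite (loopv _ _ _ _ _ _ _ reg' step') ltnn.
- exists m, T, false, (M 1 5).
  have reg3 : regs M3 false n t 0 q (M 1 5) by split; split.
  by split; rewrite ?addn0.
- case: I4 => m4 [T4 [acc [eta [[[R0' R1' R2'] _] _ step4 le5 [snd cpl]]]]].
  have X5 := exec_set (let: And4 _ _ _ c := step4 in c) (isT : 2 <= 12) (isT : fits (reg 2 +' 1)).
  have tE : den M4 (reg 2 +' 1) = t.+1 by rewrite -[LHS]/(M4 1 2 + 1) R2' addn1.
  rewrite tE in X5.
  do 2 eexists; exists m4, T4, acc; split.
  + exact: ExecSeq X1 (ExecSeq X2 (ExecSeq X3 (ExecSeq X4 X5))).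
  + by split.
  + split=> // -[i [j [k [ilt jlt klt tri]]]].
    (* Reversal is an involution, so the decisive slot of [i] is met in round
       [slot_index (6 * n + 2 * i)]. *)
    have si : slot_index (slot_index (6 * n + 2 * i)) = 6 * n + 2 * i.
      by rewrite /slot_index; case: (inc) => //; lia.
    by apply: (cpl i j k ilt jlt klt tri _ _ si); apply: slot_index_lt; lia.
  + by rewrite mulSnr; apply: (@in_step_reg _ _ _ _ 2 t.+1 _ step4); lia.
  + rewrite /query_cost; move: le4 le5 X4; rewrite /= => le4 le5 _.
    by move: (12 * n * _) le5 => z; lia.
Qed.

End Simulation.

(** * Preprocessing *)

Lemma static_layer l : l < 12 -> l %% 3 != 2 ->
  (l == 0) + (l == 10) = ~~ dynamic l.
Proof. by rewrite /dynamic; do 12 (case: l => [|l] //). Qed.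

Section Init.
Variables (n : nat) (a : rel nat) (bit : nat -> nat -> bool) (inc : bool).
Variables (B b b0 : nat) (p : prog).
Hypotheses (n_gt0 : 0 < n) (B12 : 12 <= B) (leB : (12 * n) * (12 * n) <= B).
Hypotheses (leb : B ^ max_deg <= b) (leb0 : b0 <= b).

Definition initial_time : nat := if inc then slots n else 0.

(** Whatever the bits, all gates are present at time 0 and absent at time [slots]. Hence the initial
    graph can be written before any query is known. *)
Lemma expiry_lt l i j : i < n -> j < n -> expiry n bit l i j < slots n.
Proof.
move=> ilt jlt; have g3 := gate_bit_lt n_gt0 l ilt jlt.
have qn := gate_query_lt n_gt0 l i j.
rewrite /expiry /slots; move: (gate_query _ _ _ _) (gate_bit _ _ _ _) qn g3 => q g qn g3.
have : bit q g * (6 * n) + (g * 2 + (l %% 3 == 0)) < 12 * n.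
  by case: (bit _ _); case: (_ == 0) => /=; lia.
by move: (12 * n) (_ + _) => L z zL; nia.
Qed.

Lemma den_weight M h : h < (12 * n) * (12 * n) -> M 1 1 = n -> M 1 3 = h ->
  (forall i j, i < n -> j < n -> M 0 (1 + (i * n + j)) = a i j) ->
  den M (weightE inc) =
  weight n a bit initial_time (h %/ (12 * n)) (h %% (12 * n)).
Proof.
move=> hlt R1 R3 adj; set x := h %/ _; set y := h %% _.
have xlt : x < 12 * n by rewrite ltn_divLR ?nodes_gt0.
set l := x %/ n; set i := x %% n; set j := y %% n.
have l12 : l < 12 by rewrite ltn_divLR.
have [ilt jlt] : i < n /\ j < n by rewrite !ltn_mod.
pose up := nat_of_bool (l %% 3 == 0).
have eE : up * i + (1 - up) * j = elem l i j.
  by rewrite /up /elem; case: (_ == 0); rewrite ?mul1n ?mul0n ?addn0.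
have sE : up * j + (1 - up) * i = shuttle l i j.
  by rewrite /up /shuttle; case: (_ == 0); rewrite ?mul1n ?mul0n ?addn0.
pose st := nat_of_bool (l == 0) + nat_of_bool (l == 10).
have -> : den M (weightE inc) = (y %/ n == l + 1) *
  ((l %% 3 == 2) * (a i j * (n * n)) + (1 - (l %% 3 == 2)) *
    (st * (n * n) + (1 - st) * ((if inc then 0 else 1) *
      level n (gate_query n l i j) (role l) (elem l i j)))).
  rewrite -adj // /level /gate_query -eE -sE /st /up /l /i /j /x /y -R3 -R1.
  by rewrite /weightE; case: (inc).
rewrite addn1 /weight -/l -/i -/j; congr (_ * _).
rewrite /layer_weight.
have -> : (initial_time <= expiry n bit l i j) = ~~ inc.
  by rewrite /initial_time; case: (inc) => //=; rewrite leqNgt expiry_lt.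
have : l %% 3 != 2 -> st = ~~ dynamic l.
  exact: static_layer.
move: (n * n) (level _ _ _ _) => u v.
have tE x : true * x = x := mul1n x; have fE x : false * x = 0 := mul0n x.
case: (l %% 3 == 2) => [_|-> //]; first by rewrite tE subnn mul0n addn0.
rewrite fE [1 - false]subn0 mul1n add0n.
case: (dynamic l); last by rewrite tE subnn mul0n addn0.
by rewrite fE [1 - _]subn0 mul1n add0n; case: (inc); rewrite ?tE ?fE ?mul1n ?mul0n.
Qed.

Definition initial_request : seq nat :=
  [:: 12 * n, source n_gt0 : nat, target n_gt0 : nat & entries (graph n a bit initial_time)].

Lemma nth_initial_request h : h < (12 * n) * (12 * n) ->
  nth 0 initial_request (h + 3) =
  weight n a bit initial_time (h %/ (12 * n)) (h %% (12 * n)).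
Proof.
move=> hlt; rewrite addnC /=.
have xlt : h %/ (12 * n) < 12 * n by rewrite ltn_divLR ?nodes_gt0.
have ylt : h %% (12 * n) < 12 * n by rewrite ltn_mod nodes_gt0.
by rewrite {1}(divn_eq h (12 * n)) (nth_entries _ _ (Ordinal xlt) (Ordinal ylt)) mxE.
Qed.

(** The memory expected after [h] rounds of the filling loop; the offset 3 skips the size and the
    two terminals that precede the matrix. *)
Definition init_memory (inp : seq nat) (h : nat) : memory := fun arr i =>
  match arr with
  | 0 => nth 0 inp i
  | 1 => match i with 1 => n | 3 => h | _ => 0 end
  | 2 => if i < h + 3 then nth 0 initial_request i else 0
  | _ => 0
  end.

Definition init_loopE := reg 3 <' sizeE *' sizeE.
Definition init_step_cost : nat :=
  cost init_loopE + cost (reg 3 +' 3) + cost (weightE inc) + cost (reg 3 +' 1) + 4.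
Definition init_cost : nat :=
  cost (Read 0 0) + cost sizeE + cost (11 *' nE) + cost init_loopE + 10.

Lemma exec_init inp t m' :
  (forall i, nth 0 inp i <= B) -> nth 0 inp 0 = n ->
  (forall i j, i < n -> j < n -> nth 0 inp (1 + (i * n + j)) = a i j) ->
  exec b0 p (mem_input (fun _ _ => 0) initial_request) t m' ->
  m' 1 0 <= B ->
  exists tm M',
  [/\ exec b (init_prog inc p) (mem_input (fun _ _ => 0) inp) tm M',
      tm <= init_cost + (12 * n) * (12 * n) * init_step_cost + t,
      M' 1 1 = n /\ M' 1 2 = 0, simulates M' m' & bounded B M'].
Proof.
move=> inpB inp0 inpA ex m'B.
have n12 : 12 * n <= B by apply: leq_trans leB; rewrite leq_pmulr // nodes_gt0.
have nB : n <= B by lia.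
have inpE i : mem_input (fun _ _ => 0) inp 0 i = nth 0 inp i.
  by rewrite /mem_input /=; case: ltnP => // ?; rewrite nth_default.
set M0 := mem_input _ inp in inpE *.
have bM0 : bounded B M0 by split=> // i; rewrite inpE.
have X1 := exec_set B12 leb bM0 (isT : 1 <= 12) (isT : fits (Read 0 0)).
have R0 : den M0 (Read 0 0) = n by rewrite /= inpE.
rewrite R0 in X1; set M1 := mem_upd M0 1 1 n in X1.
have bM1 : bounded B M1 by exact: bounded_reg.
have X2 := exec_write B12 leb 2 bM1 (isT : fits (Const 0)) (isT : fits sizeE).
set M2 := mem_upd M1 2 0 _ in X2.
have X3 := exec_write B12 leb 2 (bM1 : bounded B M2) (isT : fits (Const 2)) (isT : fits (11 *' nE)).
set M3 := mem_upd M2 _ _ _ in X3.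
pose I h s M := (forall arr i, M arr i = init_memory inp h arr i) /\ s <= h * init_step_cost.
have bI h s M : h <= (12 * n) * (12 * n) -> I h s M -> bounded B M.
  move=> hle [ME _]; split=> [i|i i6|]; rewrite ME //=.
  by case: i i6 => [|[|[|[|]]]] // _; apply: leq_trans hle leB.
have fl : fits init_loopE by vm_compute.
have loopv h s M : h <= (12 * n) * (12 * n) -> I h s M ->
    eval b M init_loopE = Some (nat_of_bool (h < (12 * n) * (12 * n))).
  move=> hle IM; rewrite (eval_fits B12 leb (bI _ _ _ hle IM) fl); case: IM => ME _.
  by rewrite -[den _ _]/(nat_of_bool (M 1 3 < (12 * M 1 1) * (12 * M 1 1))) !ME.
have [|||tl [sl [M4 [X4 I4 le4]]]] := @exec_count b init_loopE
  (Write 2 (reg 3 +' 3) (weightE inc);; set_reg 3 (reg 3 +' 1)) I ((12 * n) * (12 * n)) _ _ 0 0 M3 isT.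
- move=> h s M hlt IM; split; first by rewrite (loopv _ _ _ (ltnW hlt) IM) hlt.
  have bM := bI _ _ _ (ltnW hlt) IM; case: IM => ME sle.
  have fw : fits (weightE inc) by rewrite /fits; case: (inc); vm_compute.
  have Y1 := exec_write B12 leb 2 bM (isT : fits (reg 3 +' 3)) fw.
  rewrite (@den_weight M h) // in Y1; try by rewrite ?ME.
  * rewrite -[den _ _]/(M 1 3 + 3) (ME 1 3 : M 1 3 = h) in Y1.
    set M5 := mem_upd M _ _ _ in Y1.
    have Y2 := exec_set B12 leb (bM : bounded B M5) (isT : 3 <= 12) (isT : fits (reg 3 +' 1)).
    rewrite -[den M5 _]/(M 1 3 + 1) (ME 1 3 : M 1 3 = h) [h + 1]addn1 in Y2.
    do 2 eexists; split; first exact: ExecSeq Y1 Y2.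
    split; last by rewrite mulSn; move: sle; move: (h * _) => z; rewrite /init_step_cost; lia.
    move=> arr i; rewrite /M5 /mem_upd ME.
    case: arr => [|[|[|arr]]] //; first by case: i => [|[|[|[|]]]].
    rewrite /= -nth_initial_request // addSn ltnS [i <= _]leq_eqVlt.
    by case: eqP => [->|_].
  * by move=> i j ilt jlt; rewrite ME /= inpA.
- move=> s M IM; by rewrite (loopv _ _ _ (leqnn _) IM) ltnn.
- split=> // arr i; rewrite /M3 /M2 /M1 /mem_upd.
  case: arr => [|[|[|arr]]] /=.
  + by rewrite inpE.
  + by case: i => [|[|[|[|]]]].
  + case: i => [|[|[|i]]] //=.
    (* The program never writes the source: it is node 0 and the memory is initially zero. *)
    * by rewrite val_node ?nodes_gt0.
    * by rewrite val_node //; lia.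
  + by rewrite /M0 /mem_input.
- have sim4 : simulates M4 (mem_input (fun _ _ => 0) initial_request).
    have sz : size initial_request = (12 * n) * (12 * n) + 3.
      by rewrite /= size_entries addn3.
    by move=> arr i; case: I4 => -> _; rewrite /mem_input sz; case: arr.
  have [M' [X5 sim' I0 I1]] := exec_shift (exec_mono leb0 ex) sim4.
  have bM4 := bI _ _ _ (leqnn _) I4.
  do 2 eexists; split.
  + exact: ExecSeq X1 (ExecSeq X2 (ExecSeq X3 (ExecSeq X4 X5))).
  + case: I4 => _ le5; rewrite /init_cost.
    move: le4 le5; move: (12 * n * (12 * n) * _) => z; rewrite [cost (Const 0)]/= [cost (Const 2)]/=; lia.
  + by rewrite !I1; case: I4 => ME _; rewrite !ME.
  + exact: sim'.
  + case: bM4 => c0 c1 c3; split=> [i|i i6|]; rewrite ?I0 ?I1 ?sim' //; exact: c1.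
Qed.

End Init.

(** * The reduction *)

Lemma size_handles_all b p m rs T : handles_all b p m rs T -> size rs <= T.
Proof. by elim=> //= m1 m2 r rs' t T' [/exec_gt0 t0 _] _; lia. Qed.

Lemma size_stBP_updates n (s t : 'I_n) G us : size (stBP_updates s t G us) = size us.
Proof. by elim: us G => //= u us IH G; rewrite IH. Qed.

Section Reduction.
Variables (n : nat) (A : 'M[bool]_n).
Variable qs : seq ('rV[bool]_n * 'rV[bool]_n * 'rV[bool]_n).
Variables (inc : bool).
Hypotheses (n_gt0 : 0 < n) (size_qs : size qs = n).

Definition adj (i j : nat) : bool := nth false (entries A) (i * n + j).

Definition query_entries (q : 'rV[bool]_n * 'rV[bool]_n * 'rV[bool]_n) : seq bool :=
  entries q.1.1 ++ entries q.1.2 ++ entries q.2.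

Definition query_at (t : nat) : 'rV[bool]_n * 'rV[bool]_n * 'rV[bool]_n :=
  nth (0, 0, 0)%R qs t.

(** [q] numbers queries in schedule order; [query_index] translates it to the order of arrival and
    is its own inverse. *)
Definition query_bit (q g : nat) : bool :=
  nth false (query_entries (query_at (query_index n inc q))) g.

Lemma query_indexK t : t < n -> query_index n inc (query_index n inc t) = t.
Proof. by rewrite /query_index; case: inc => //; lia. Qed.

Lemma nth_nat_of_bool (s : seq bool) i :
  nth 0 (map nat_of_bool s) i = nth false s i.
Proof.
by case: (ltnP i (size s)) => lt; [rewrite (nth_map false)|rewrite !nth_default ?size_map].
Qed.

Lemma size_query_entries q : size (query_entries q) = 3 * n.
Proof. by rewrite !size_cat !size_entries; lia. Qed.

Lemma OMv3_queryE q : (OMv3_query A q).1 = map nat_of_bool (query_entries q).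
Proof. by case: q => [[u v] w]; rewrite /= !map_cat. Qed.

Lemma OMv3_query_correct t (b : bool) : t < n ->
  b <-> has_triangle n adj query_bit (query_index n inc t) ->
  (OMv3_query A (query_at t)).2 (nat_of_bool b).
Proof.
move=> tn; rewrite /has_triangle /triangle /query_bit query_indexK //.
case: (query_at t) => [[u v] w] /= bE; congr nat_of_bool.
have uE (x : 'rV[bool]_n) (i : 'I_n) s : nth false (entries x ++ s) i = x ord0 i.
  by rewrite nth_cat size_entries mul1n ltn_ord -(nth_entries x false ord0 i).
have sz (x : 'rV[bool]_n) : size (entries x) = n by rewrite size_entries mul1n.
have bitE (i j k : 'I_n) : [/\ nth false (query_entries (u, v, w)) i = u ord0 i,
   nth false (query_entries (u, v, w)) (n + j) = v ord0 j &
   nth false (query_entries (u, v, w)) (2 * n + k) = w ord0 k].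
  rewrite /query_entries /= uE; split=> //.
    by rewrite nth_cat sz ltnNge leq_addr /= addKn uE.
  rewrite nth_cat sz ltnNge (_ : n <= 2 * n + k) /=; last by lia.
  rewrite nth_cat sz ltnNge (_ : n <= 2 * n + k - n) /=; last by lia.
  rewrite (_ : 2 * n + k - n - n = k); last by lia.
  by rewrite -[entries w]cats0 uE.
have aE (i j : 'I_n) : adj i j = A i j by exact: nth_entries.
apply/idP/existsP => [/bE[i [j [k [ilt jlt klt]]]]|[i /existsP[j /existsP[k tri]]]].
  have [b1 b2 b3] := bitE (Ordinal ilt) (Ordinal jlt) (Ordinal klt).
  rewrite b1 b2 b3 (aE (Ordinal ilt) (Ordinal jlt)) (aE (Ordinal jlt) (Ordinal klt)).
  rewrite (aE (Ordinal klt) (Ordinal ilt)) => tri.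
  exists (Ordinal ilt); apply/existsP; exists (Ordinal jlt).
  by apply/existsP; exists (Ordinal klt).
apply/bE; exists i, j, k; split=> //.
by have [-> -> ->] := bitE i j k; rewrite !aE.
Qed.

Variables (B b b0 : nat) (p : prog).
Hypotheses (B12 : 12 <= B) (leB : (12 * n) * (12 * n) <= B).
Hypotheses (leb : B ^ max_deg <= b) (leb0 : b0 <= b).

Notation in_step := (in_step adj query_bit inc B b0 p n_gt0).

Lemma handles_queries d t M m T : t + d = n -> M 1 1 = n -> M 1 2 = t ->
  in_step M m (t * (12 * n)) T ->
  exists T', handles_all b (query_prog inc p) M
               [seq OMv3_query A q | q <- drop t qs] T' /\
    T' <= d * (query_cost inc + 12 * n * (slot_cost inc + cost loopE + 1)) + T.
Proof.
have leB1 : 12 * n <= B by apply: leq_trans leB; rewrite leq_pmulr // nodes_gt0.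
have leB2 : n * n <= B by apply: leq_trans leB; rewrite leq_mul // leq_pmull.
elim: d => [|d IH] in t M m T *.
  rewrite addn0 => -> _ _ _; exists 0; split; last by [].
  by rewrite drop_oversize ?size_qs //; apply: HandlesNil.
move=> tE R1 R2 step; have tn : t < n by lia.
rewrite (drop_nth (0, 0, 0)%R) ?size_qs //= -/(query_at t).
set r := OMv3_query A (query_at t); pose M0 := mem_input M r.1.
have szr : size r.1 = 3 * n by rewrite OMv3_queryE size_map size_query_entries.
(* The schedule depends on all queries, but the program reads only the bits of the current one,
   which have just been loaded. *)
have inp g : g < 3 * n -> M0 0 g = query_bit (query_index n inc t) g.
  move=> g3; rewrite /M0 /mem_input szr g3 /= OMv3_queryE nth_nat_of_bool.
  by rewrite /query_bit query_indexK.
have step0 : in_step M0 m (t * (12 * n)) T.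
  case: step => sim val hdl [c0 c1 c3]; split=> //; split=> // i.
  rewrite /M0 /mem_input /=; case: ifP => // _.
  by rewrite OMv3_queryE nth_nat_of_bool; case: (nth _ _ _) => //; lia.
have [tm [M' [m' [T1 [acc [ex [a0 a1 a2] ok step1 le1]]]]]] :=
  exec_query B12 leB1 leB2 leb leb0 tn (R1 : M0 1 1 = n) (R2 : M0 1 2 = t) inp step0.
have [|T2 [hdl le2]] := IH t.+1 M' m' T1 _ a1 a2 step1; first by lia.
exists (tm + T2); split; last first.
  set Q := query_cost inc + _ * _ in le1 le2 *.
  by rewrite mulSn; move: (d * Q) le2 => x le2; lia.
apply: HandlesCons hdl; split; first exact: ex.
by rewrite /answer a0; apply: OMv3_query_correct.
Qed.

End Reduction.

(** * Total time and transfer of the lower bound *)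

Definition time_factor (inc : bool) : nat :=
  query_cost inc + 12 * (slot_cost inc + cost loopE + 1) + 1.

Lemma leq_expn_add x i j : 1 < x -> x ^ i + x ^ j <= x ^ (i + j).+1.
Proof.
move=> x1; have le_ij : x ^ i <= x ^ (i + j) by rewrite leq_pexp2l ?leq_addr // ltnW.
have le_ji : x ^ j <= x ^ (i + j) by rewrite leq_pexp2l ?leq_addl // ltnW.
rewrite expnS; apply: (@leq_trans (2 * x ^ (i + j))); first by lia.
by rewrite leq_mul2r x1 orbT.
Qed.

Lemma solves_OMv3 (R : realType) inc c alg (f f' : nat -> R) : 1 < c ->
  (forall n, 0 < n -> ((time_factor inc)%:R * f (12 * n)%N <= f' n)%R) ->
  solves_in (dynamic_stBP (@update_ok inc) c) alg f ->
  solves_in OMv3 (OMv3_algorithm inc alg) f'.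
Proof.
move=> c1 ff' [k solve]; pose C := init_cost + init_step_cost inc.
(* The first summand covers the words, as [B = X ^ 8]. The second covers preprocessing:
   [X ^ (8 + C)] for writing the graph and [X ^ (4 * k)] for the simulated run on [12 * n] nodes. *)
exists (8 * max_deg + (8 + C + 4 * k).+1).
move=> n r rs n_gt0 [A [qs [size_qs -> ->]]] /=.
set K := 8 * max_deg + _; pose X := n + 2; rewrite -/X.
have X3 : 3 <= X by rewrite /X; lia.
have X1 : 1 < X by lia.
have expX i j : i <= j -> X ^ i <= X ^ j by move=> ij; rewrite leq_pexp2l //; lia.
have leX4 : 12 * n + 2 <= X ^ 4.
  have : 3 * (3 * 3) <= X * (X * X) by rewrite !leq_mul.
  by rewrite !expnS expn0 muln1 /X; nia.
pose B := X ^ 8.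
have leB : (12 * n) * (12 * n) <= B.
  by rewrite /B -[8]/(4 + 4) expnD leq_mul //; apply: leq_trans leX4; rewrite leq_addr.
have B12 : 12 <= B by apply: leq_trans leB; nia.
have leb : B ^ max_deg <= X ^ K by rewrite -expnM expX // /K leq_addr.
pose a := adj A; pose bit := query_bit qs inc.
have state0 : state n a bit inc 0 = graph n a bit (initial_time n inc).
  by rewrite /state subn0.
have N0 := nodes_gt0 n_gt0.
(* The given algorithm is applied to the complete update sequence; the simulating program generates
   the same sequence query by query. *)
have [|t [T [m [hdl0 tle hdl Tle]]]] := solve _
  (initial_request a bit inc n_gt0, stBP_value (state n a bit inc 0) (source n_gt0) (target n_gt0))
  (request_updates a bit inc n_gt0 0) N0.
  exists (state n a bit inc 0), (source n_gt0), (target n_gt0), (updates_from bit inc n_gt0 0).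
  split=> //.
  - exact: wdigraph_graph.
  - exact: source_neq_target.
  - exact: updates_legal.
  - by rewrite state0.
set b0 := (12 * n + 2) ^ k in hdl0 tle hdl.
have b0X : b0 <= X ^ (4 * k) by rewrite expnM /b0; case: (k) => // j; rewrite leq_exp2r.
have leb0 : b0 <= X ^ K by apply: leq_trans b0X _; apply: expX; rewrite /K; lia.
case: hdl0 => ex val.
pose inp := n :: bits A.
have inpE i : nth 0 inp i.+1 = nth false (entries A) i by exact: nth_nat_of_bool.
have n12 : 12 * n <= B by apply: leq_trans leB; rewrite leq_pmulr.
have inpB i : nth 0 inp i <= B.
  case: i => [|i]; first by rewrite /=; lia.
  by rewrite inpE; case: (nth _ _ _) => //; lia.
have leB2 : n * n <= B by apply: leq_trans leB; rewrite leq_mul // leq_pmull.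
have mB : m 1 0 <= B := value_le leB2 val.
have [|tm [M [ex' tmle [M1 M2] sim bM]]] :=
  exec_init B12 leB leb leb0 inpB erefl _ ex mB; first by move=> i j _ _; exact: inpE.
have step : in_step a bit inc B b0 (serve alg) n_gt0 M m (0 * (12 * n)) T by split.
have [T' [hdl' T'le]] := handles_queries size_qs B12 leB leb leb0 (add0n n) M1 M2 step.
exists tm, T', M; split.
- by split; first exact: ex'.
- apply: leq_trans tmle _.
  apply: (@leq_trans (X ^ (8 + C) + X ^ (4 * k))).
    apply: leq_add; last exact: leq_trans b0X.
    rewrite expnD; apply: (@leq_trans (X ^ 8 * C)); last first.
      by rewrite leq_mul2l (ltnW (ltn_expl _ X1)) orbT.
    rewrite /C mulnDr; apply: leq_add; first by rewrite leq_pmull // expn_gt0; lia.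
    by rewrite leq_mul2r leB orbT.
  by apply: leq_trans (leq_expn_add _ _ X1) _; apply: expX; rewrite /K; lia.
- by rewrite drop0 in hdl'.
- apply: le_trans (ff' _ n_gt0).
  apply: (@le_trans _ _ ((time_factor inc)%:R * T%:R)%R); last by rewrite ler_wpM2l.
  rewrite -natrM ler_nat; apply: leq_trans T'le _.
  have nT : n * n <= T.
    apply: leq_trans (updates_size bit inc n_gt0) _.
    by have := size_handles_all hdl; rewrite size_stBP_updates.
  rewrite /time_factor mulnDl mul1n; apply: leq_add => //.
  apply: (@leq_trans ((n * n) * (query_cost inc + 12 * (slot_cost inc + cost loopE + 1)))).
    move: (query_cost inc) (slot_cost inc + _ + _) => x z.
    by rewrite -[n * n * _]mulnA leq_mul // mulnDr mulnCA [12 * n * z]mulnAC leq_add //; nia.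
  by rewrite mulnC leq_mul2l nT orbT.
Qed.

Lemma requires_time_of_OMv3 (R : realType) inc c (e : R) : 1 < c ->
  requires_total_time OMv3 e ->
  requires_total_time (dynamic_stBP (@update_ok inc) c) e.
Proof.
move=> c1 hard eps alg eps0 [C solve].
apply: (hard eps (OMv3_algorithm inc alg) eps0).
(* The growth from [n] to [12 * n] nodes costs only a fixed power of 12, whatever the sign of the
   exponent. *)
exists ((time_factor inc)%:R * (C * 12 `^ (e - eps)))%R.
apply: solves_OMv3 c1 _ solve => n n_gt0.
by rewrite natrM powRM // !mulrA.
Qed.

Theorem theorem4p14 (R : realType) (c : nat) (hc : (2 <= c)%N) :
  OMv3_hypothesis R ->
  requires_total_time (incremental_stBP c) (omega R + 1)%R /\
  requires_total_time (decremental_stBP c) (omega R + 1)%R.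
Proof.
move=> hard; split.
- exact: (@requires_time_of_OMv3 _ true).
- exact: (@requires_time_of_OMv3 _ false).
Qed.
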